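(* Let $M$ be a connected, complete Riemannian manifold of dimension $n\ge 2$ with constant sectional curvature $K\neq 0$. Let $U\subset M$ be an open subset, and let $f:U\to\mathbb{C}$ be a smooth function with $\Delta f=-\lambda f$ on $U$ for some $\lambda\in\mathbb{C}$. Let $k\ge 1$ be an integer and let $\theta=\sum_{i=1}^n X_i\otimes X_i$, where $X_1,\dots,X_n$ is any local orthonormal frame. Then for every permutation $\sigma\in \mathrm{Sym}_{2k}$, $$(\nabla^{2k}f)(\sigma(\theta^{\otimes k}))\in\mathbb{C}f .$$
   Context: $\nabla$ is the Levi-Civita connection. Iterated covariant derivatives are defined by $\nabla^1 f=df$ and $(\nabla^m f)(Z_1,\dots,Z_m)=(\nabla_{Z_1}(\nabla^{m-1}f))(Z_2,\dots,Z_m)$; $(\nabla^m f)(\cdot)$ is extended linearly to sections of the $m$-th tensor power of the complexified tangent bundle, so $(\nabla^mf)(Z_1\otimes\cdots\otimes Z_m)=(\nabla^mf)(Z_1,\dots,Z_m)$. $\Delta f=\sum_i(\nabla^2f)(X_i,X_i)$ is the Laplace-Beltrami operator. The tensor $\theta$ does not depend on the choice of orthonormal frame, hence is globally defined. $\mathrm{Sym}_r$ is the symmetric group on $\{1,\dots,r\}$, acting on $r$-tensors by $\sigma(v_1\otimes\cdots\otimes v_r)=v_{\sigma^{-1}(1)}\otimes\cdots\otimes v_{\sigma^{-1}(r)}$. *)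

(* Defs.v *)
From HB Require Import structures.
From mathcomp Require Import all_boot all_order all_algebra all_fingroup.
From mathcomp Require Import complex.
From mathcomp Require Import all_classical all_reals all_analysis.
From mathcomp Require Import ring lra.

Set Implicit Arguments.
Unset Strict Implicit.
Unset Printing Implicit Defensive.

Import Order.TTheory GRing.Theory Num.Theory.
Import numFieldNormedType.Exports.

Local Open Scope classical_set_scope.
Local Open Scope ring_scope.
Local Open Scope complex_scope.

(* Coordinates on R^n are row vectors, and indices run over 'I_n.             *)

Definition pd (R : realType) n (i : 'I_n) (h : 'rV[R]_n -> R) : 'rV[R]_n -> R :=
  'D_(delta_mx 0 i) h.

Definition pdC (R : realType) n (i : 'I_n) (h : 'rV[R]_n -> R[i]) :
    'rV[R]_n -> R[i] :=
  fun x => pd i (fun y => complex.Re (h y)) x +i* pd i (fun y => complex.Im (h y)) x.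

(* C^oo on an open set D: all iterated partial derivatives exist and are      *)
(* continuous at every point of D.                                            *)
Definition smooth_on (R : realType) n (D : set 'rV[R]_n) (h : 'rV[R]_n -> R) :=
  forall (s : seq 'I_n) (x : 'rV[R]_n), D x ->
    {for x, continuous (foldr (@pd R n) h s)} /\
    forall i : 'I_n, derivable (foldr (@pd R n) h s) x (delta_mx 0 i).

Definition smoothC_on (R : realType) n (D : set 'rV[R]_n)
    (h : 'rV[R]_n -> R[i]) :=
  smooth_on D (fun x => complex.Re (h x)) /\
  smooth_on D (fun x => complex.Im (h x)).

(* A smooth Riemannian manifold of dimension n, given by an atlas.  The chart *)
(* a maps the open set dom a homeomorphically to the open set                 *)
(* phi a @` dom a of R^n, with inverse psi a; metric a x is the Gram matrix   *)
(* of the metric in the coordinate frame of the chart a at psi a x.           *)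
Record riemannianManifold (R : realType) (n : nat) := RiemannianManifold {
  pts :> topologicalType;
  pts_hausdorff : hausdorff_space pts;
  pts_second_countable : @second_countable pts;
  chart : Type;
  dom : chart -> set pts;
  phi : chart -> pts -> 'rV[R]_n;
  psi : chart -> 'rV[R]_n -> pts;
  dom_open : forall a, open (dom a);
  cod_open : forall a, open (phi a @` dom a);
  dom_cover : forall p, exists a, dom a p;
  phiK : forall a p, dom a p -> psi a (phi a p) = p;
  phi_continuous : forall a p, dom a p -> {for p, continuous (phi a)};
  psi_continuous : forall a x, (phi a @` dom a) x ->
    {for x, continuous (psi a)};
  transition_smooth : forall a b (i : 'I_n),
    smooth_on ((phi a @` dom a) `&` (psi a @^-1` dom b))
      (fun x => phi b (psi a x) 0 i);
  metric : chart -> 'rV[R]_n -> 'M[R]_n;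
  metric_smooth : forall a (i j : 'I_n),
    smooth_on (phi a @` dom a) (fun x => metric a x i j);
  metric_sym : forall a x, (phi a @` dom a) x -> (metric a x)^T = metric a x;
  metric_pos : forall a x (v : 'rV[R]_n), (phi a @` dom a) x -> v != 0 ->
    0 < (v *m metric a x *m v^T) 0 0;
  metric_transition : forall a b x,
    (phi a @` dom a) x -> dom b (psi a x) ->
    let J := 'J (phi b \o psi a) x in
    metric a x = J *m metric b (phi b (psi a x)) *m J^T
}.

Definition cod (R : realType) n (M : riemannianManifold R n) (a : chart M) :
  set 'rV[R]_n := phi a @` dom a.

(* Local Riemannian geometry of a metric G on an open set of R^n.             *)

Definition inner (R : realType) n (g : 'M[R]_n) (u v : 'rV[R]_n) : R :=
  (u *m g *m v^T) 0 0.

(* christoffel G l i j is Gamma^l_ij, i.e. for the Levi-Civita connection,    *)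
(* nabla_{d_i} d_j = \sum_l Gamma^l_ij d_l.                                   *)
Definition christoffel (R : realType) n (G : 'rV[R]_n -> 'M[R]_n)
    (l i j : 'I_n) (x : 'rV[R]_n) : R :=
  2^-1 * \sum_m invmx (G x) l m *
    (pd i (fun y => G y j m) x + pd j (fun y => G y i m) x
     - pd m (fun y => G y i j) x).

(* Torsion-freeness and compatibility with the metric characterize the        *)
(* Christoffel symbols.                                                       *)
Lemma christoffel_levi_civita (R : realType) n (G : 'rV[R]_n -> 'M[R]_n)
    (x : 'rV[R]_n) (A : 'I_n -> 'I_n -> 'I_n -> R) :
  (\forall y \near x, (G y)^T = G y) -> G x \in unitmx ->
  (forall l i j, A l i j = A l j i) /\
  (forall k i j, pd k (fun y => G y i j) x
     = \sum_l (A l k i * G x l j + A l k j * G x i l))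
  <-> (forall l i j, A l i j = christoffel G l i j x).
Proof.
move=> Gsym Gu.
have Psym k i j : pd k (fun y => G y i j) x = pd k (fun y => G y j i) x.
  apply: near_eq_derive; near=> y.
  have e : (G y)^T = G y by near: y.
  by rewrite -[in LHS]e mxE.
have Gs i j : G x i j = G x j i.
  by rewrite -[in LHS](nbhs_singleton Gsym) mxE.
set P := fun k i j => pd k (fun y => G y i j) x.
have solve (B : 'I_n -> R) (c : 'I_n -> R) :
  (forall m, \sum_l B l * G x l m = c m) <->
  (forall l, B l = \sum_m invmx (G x) l m * c m).
  have iGs l m : invmx (G x) l m = invmx (G x) m l.
    have e : (G x)^T = G x by apply/matrixP => i j; rewrite mxE.
    by rewrite -[in LHS]e -trmx_inv mxE.
  split=> [Bc l|Bc m].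
    under eq_bigr do rewrite -Bc iGs.
    have := congr1 (fun v : 'rV_n => v 0 l) (mulmxK Gu (\row_l B l)).
    rewrite !mxE => <-; apply: eq_bigr => m _; rewrite !mxE mulrC.
    by congr (_ * _); apply: eq_bigr => k _; rewrite mxE.
  have := congr1 (fun v : 'rV_n => v 0 m) (mulmxKV Gu (\row_l c l)).
  rewrite !mxE => <-; apply: eq_bigr => l _; rewrite !mxE Bc.
  by congr (_ * _); apply: eq_bigr => k _; rewrite mxE iGs mulrC.
pose L i j m := \sum_l A l i j * G x l m.
have metE k i j : \sum_l (A l k i * G x l j + A l k j * G x i l)
                = L k i j + L k j i.
  by rewrite big_split /=; congr (_ + _); apply: eq_bigr => l _; rewrite Gs.
have chrE i j : (forall l, A l i j = christoffel G l i j x) <->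
    (forall m, L i j m = 2^-1 * (P i j m + P j i m - P m i j)).
  rewrite (solve (fun l => A l i j)).
  have eqc l : christoffel G l i j x =
    \sum_m invmx (G x) l m * (2^-1 * (P i j m + P j i m - P m i j)).
    rewrite /christoffel mulr_sumr; apply: eq_bigr => m _.
    by rewrite mulrCA.
  by split=> H l; rewrite H eqc.
split.
  case=> Asym Amet l i j; move: l; apply/chrE => m.
  have Lsym a b c : L a b c = L b a c by apply: eq_bigr => l _; rewrite Asym.
  rewrite /P !Amet !metE (Lsym j i m) (Lsym m i j) (Lsym m j i).
  by field.
move=> AE.
have LE i j m : L i j m = 2^-1 * (P i j m + P j i m - P m i j).
  by move: m; apply/chrE => l.
split=> [l i j|k i j].
  rewrite !AE /christoffel; congr (_ * _); apply: eq_bigr => m _.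
  by rewrite (Psym m i j) [X in X - _]addrC.
rewrite metE !LE (Psym i k j : P i k j = P i j k).
rewrite (Psym j k i : P j k i = P j i k) (Psym k j i : P k j i = P k i j).
rewrite -/(P k i j); field.
Unshelve. all: by end_near. Qed.

(* A covariant m-tensor field is given by its components on tuples of         *)
(* coordinate fields, indexed by {ffun 'I_m -> 'I_n}.                         *)
Definition idx_tail n m (j : {ffun 'I_m.+1 -> 'I_n}) : {ffun 'I_m -> 'I_n} :=
  [ffun b => j (lift ord0 b)].

Definition idx_set n m (j : {ffun 'I_m -> 'I_n}) (b : 'I_m) (l : 'I_n) :
    {ffun 'I_m -> 'I_n} :=
  [ffun c => if c == b then l else j c].

(* Components of nabla T, the differentiation direction coming first:         *)
(* (nabla_{d_i} T)(d_{j_1}, ..., d_{j_m}) = d_i (T(d_{j_1}, ..., d_{j_m}))    *)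
(*    - \sum_b T(d_{j_1}, ..., nabla_{d_i} d_{j_b}, ..., d_{j_m}).            *)
Definition covd (R : realType) n (G : 'rV[R]_n -> 'M[R]_n) m
    (T : {ffun 'I_m -> 'I_n} -> 'rV[R]_n -> R[i])
    (j : {ffun 'I_m.+1 -> 'I_n}) (x : 'rV[R]_n) : R[i] :=
  pdC (j ord0) (T (idx_tail j)) x
  - \sum_(b < m) \sum_(l < n)
      (christoffel G l (j ord0) (idx_tail j b) x)%:C
      * T (idx_set (idx_tail j) b l) x.

Fixpoint nabla (R : realType) n (G : 'rV[R]_n -> 'M[R]_n)
    (h : 'rV[R]_n -> R[i]) m : {ffun 'I_m -> 'I_n} -> 'rV[R]_n -> R[i] :=
  if m is m'.+1 then covd G (nabla G h (m := m')) else fun=> h.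

(* The m-th tensor power of the complexified tangent space at a point, by     *)
(* components in the coordinate frame.                                        *)
Definition tensor (R : realType) (n m : nat) : Type :=
  {ffun {ffun 'I_m -> 'I_n} -> R[i]}.

Definition tscalar (R : realType) n (c : R[i]) : tensor R n 0 := [ffun=> c].

Definition tvect (R : realType) n (v : 'rV[R]_n) : tensor R n 1 :=
  [ffun j : {ffun 'I_1 -> 'I_n} => (v 0 (j ord0))%:C].

Definition tprod (R : realType) n r s (S : tensor R n r) (T : tensor R n s) :
    tensor R n (r + s) :=
  [ffun j : {ffun 'I_(r + s) -> 'I_n} =>
     S [ffun b => j (lshift s b)] * T [ffun b => j (rshift r b)]].

Definition tpure (R : realType) n r (v : 'I_r -> 'rV[R[i]]_n) : tensor R n r :=
  [ffun j : {ffun 'I_r -> 'I_n} => \prod_(b < r) v b 0 (j b)].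

Definition tperm_act (R : realType) n r (s : 'S_r) (T : tensor R n r) :
    tensor R n r :=
  [ffun j : {ffun 'I_r -> 'I_n} => T [ffun b => j (s b)]].

Lemma tperm_act_pure (R : realType) n r (s : 'S_r) (v : 'I_r -> 'rV[R[i]]_n) :
  tperm_act s (tpure v) = tpure (fun b => v ((s^-1)%g b)).
Proof.
apply/ffunP => j; rewrite !ffunE [RHS](reindex_inj (@perm_inj _ s)) /=.
by apply: eq_bigr => b _; rewrite ffunE permK.
Qed.

Definition theta (R : realType) n (E : 'I_n -> 'rV[R]_n) : tensor R n 2 :=
  \sum_(i < n) (tprod (tvect (E i)) (tvect (E i)) : {ffun _ -> R[i]}).

Fixpoint tpow (R : realType) n (T : tensor R n 2) (k : nat) :
    tensor R n (k * 2) :=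
  if k is k'.+1 then tprod T (tpow T k') else tscalar n 1.

(* (nabla^m h)(T) at x, for a tensor T at x.                                  *)
Definition nabla_at (R : realType) n (G : 'rV[R]_n -> 'M[R]_n)
    (h : 'rV[R]_n -> R[i]) m (T : tensor R n m) (x : 'rV[R]_n) : R[i] :=
  \sum_(j : {ffun 'I_m -> 'I_n}) T j * nabla G h j x.

Definition orthonormal_frame (R : realType) n (G : 'rV[R]_n -> 'M[R]_n)
    (V : set 'rV[R]_n) (X : 'rV[R]_n -> 'I_n -> 'rV[R]_n) :=
  (forall i j, smooth_on V (fun x => X x i 0 j)) /\
  forall x, V x -> forall i j, inner (G x) (X x i) (X x j) = (i == j)%:R.

(* The Laplacian computed in the orthonormal frame X.                         *)
Definition laplacian (R : realType) n (G : 'rV[R]_n -> 'M[R]_n)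
    (X : 'rV[R]_n -> 'I_n -> 'rV[R]_n) (h : 'rV[R]_n -> R[i])
    (x : 'rV[R]_n) : R[i] :=
  \sum_(i < n) nabla_at G h (tprod (tvect (X x i)) (tvect (X x i))) x.

(* curvature G l k i j is the component R^l_kij of                            *)
(* R(d_i, d_j) d_k = nabla_{d_i} nabla_{d_j} d_k - nabla_{d_j} nabla_{d_i} d_k *)
Definition curvature (R : realType) n (G : 'rV[R]_n -> 'M[R]_n)
    (l k i j : 'I_n) (x : 'rV[R]_n) : R :=
  pd i (christoffel G l j k) x - pd j (christoffel G l i k) x
  + \sum_m (christoffel G m j k x * christoffel G l i m x
            - christoffel G m i k x * christoffel G l j m x).

Definition curvature_op (R : realType) n (G : 'rV[R]_n -> 'M[R]_n)
    (x u v w : 'rV[R]_n) : 'rV[R]_n :=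
  \row_l \sum_i \sum_j \sum_k curvature G l k i j x * u 0 i * v 0 j * w 0 k.

Definition sectional (R : realType) n (G : 'rV[R]_n -> 'M[R]_n)
    (x u v : 'rV[R]_n) : R :=
  inner (G x) (curvature_op G x u v v) u
  / (inner (G x) u u * inner (G x) v v - inner (G x) u v ^+ 2).

(* Global notions on a Riemannian manifold.                                   *)

Definition constant_sectional_curvature (R : realType) n
    (M : riemannianManifold R n) (K : R) :=
  forall (a : chart M) (x u v : 'rV[R]_n), cod a x ->
    row_free (col_mx u v) -> sectional (metric a) x u v = K.

Definition velocity (R : realType) n (M : riemannianManifold R n) (a : chart M)
    (c : R -> M) (l : 'I_n) : R -> R := derive1 (fun t => phi a (c t) 0 l).

Definition geodesic (R : realType) n (M : riemannianManifold R n)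
    (c : R -> M) :=
  continuous c /\
  forall (a : chart M) (t : R), dom a (c t) -> forall l : 'I_n,
    [/\ derivable (fun s => phi a (c s) 0 l) t 1,
        derivable (velocity a c l) t 1 &
        derive1 (velocity a c l) t
        + \sum_i \sum_j christoffel (metric a) l i j (phi a (c t))
                        * velocity a c i t * velocity a c j t = 0].

(* Geodesic completeness: every initial velocity v at every point p is that   *)
(* of a geodesic defined on all of R.                                         *)
Definition geodesically_complete (R : realType) n
    (M : riemannianManifold R n) :=
  forall (a : chart M) (p : M) (v : 'rV[R]_n), dom a p ->
    exists2 c : R -> M, geodesic c &
      c 0 = p /\ forall l, velocity a c l 0 = v 0 l.

(* A function f : U -> C is represented by a function on M of which only the  *)
(* values on U matter; (f \o psi a) is its expression in the chart a.         *)

Definition chart_part (R : realType) n (M : riemannianManifold R n)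
    (U : set M) (a : chart M) : set 'rV[R]_n :=
  cod a `&` (psi a @^-1` U).

Definition smooth_function (R : realType) n (M : riemannianManifold R n)
    (U : set M) (f : M -> R[i]) :=
  forall a : chart M, smoothC_on (chart_part U a) (f \o psi a).

(* local_frame U a V X: X is an orthonormal frame on an open V contained in   *)
(* U, everything being read in the chart a.                                   *)
Definition local_frame (R : realType) n (M : riemannianManifold R n)
    (U : set M) (a : chart M) (V : set 'rV[R]_n)
    (X : 'rV[R]_n -> 'I_n -> 'rV[R]_n) :=
  [/\ open V, V `<=` chart_part U a & orthonormal_frame (metric a) V X].

Definition laplace_eigenfunction (R : realType) n (M : riemannianManifold R n)
    (U : set M) (f : M -> R[i]) (lam : R[i]) :=
  forall (a : chart M) V X, local_frame U a V X ->
    forall x, V x ->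
      laplacian (metric a) X (f \o psi a) x = - lam * f (psi a x).

(* Main.v *)
Require Import Defs.
From HB Require Import structures.
From mathcomp Require Import all_boot all_order all_algebra all_fingroup.
From mathcomp Require Import complex.
From mathcomp Require Import all_classical all_reals all_analysis.
From mathcomp Require Import zify ring lra.

Set Implicit Arguments.
Unset Strict Implicit.
Unset Printing Implicit Defensive.

Import Order.TTheory GRing.Theory Num.Theory.
Import numFieldNormedType.Exports.

Local Open Scope classical_set_scope.
Local Open Scope ring_scope.
Local Open Scope complex_scope.

(* In an orthonormal frame, swapping two adjacent derivatives in nabla^m f     *)
(* changes it, by the Ricci identity, by K times a sum of products of a       *)
(* Kronecker delta and nabla^(m-2) f, because the curvature tensor is         *)
(* K (g ^ g) and parallel.  After contracting all indices in pairs, each of   *)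
(* these terms is again a full contraction of nabla^(m-2) f, with fewer pairs.*)
(* So by induction all contractions agree up to multiples of f, and one may   *)
(* bring a pair to the last two slots, where it gives the parallel trace      *)
(* Delta f = - lam f.  The resulting constant depends only on n, K, lam and   *)
(* the pairing.                                                               *)

(** * Tensor calculus in an orthonormal frame *)

(** The argument is algebraic once a local orthonormal frame in constant curvature is reduced to a
    [frame_calculus]: a commutative ring with derivations, skew connection coefficients without
    torsion and with curvature [K], and the frame components [hess] of the iterated derivatives. A
    full contraction is encoded by a word in which every letter occurs twice, summed over all values
    of the letters ([contract]).

    Two identities drive the induction on the length of the word in [paired_contraction]. By
    [ricci], exchanging two adjacent slots costs [- K] times [plane_rot] acting on the later slots,
    even behind a prefix of further derivatives. Each summand of that correction carries a Kronecker
    delta, which merges two letters and leaves a shorter paired word ([delta_term],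
    [curvature_term]). By [trace_tail], a pair in the last two slots contracts to [- lam]. So both
    occurrences of one letter can be carried to the end, modulo known multiples of $f$, and stripped
    off. Since [eigen] fixes its constant before the calculus, the same constant serves all charts
    and frames.

    The geometric half shows that the manifold supplies such a calculus. [constant_curvature]
    recovers the whole curvature tensor from its sectional values; [smoothRing] makes identities
    between smooth functions into equalities in a ring, with partial derivatives that commute by
    [derive_commute]; [moving_frame_calculus] passes from coordinates to the frame, and
    [local_calculus] assembles the pieces. Finally [tpow_theta] and [paired_word_pair_of] recognise
    the permuted power of $\theta$ as contraction along a paired word. *)

Section AdditiveMap.
Variables (V : zmodType) (d : V -> V).
Hypothesis dD : forall x y, d (x + y) = d x + d y.

Lemma additive_map0 : d 0 = 0.
Proof. by apply: (addIr (d 0)); rewrite -dD addr0 add0r. Qed.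

Lemma additive_mapN x : d (- x) = - d x.
Proof. by apply: (addIr (d x)); rewrite -dD !addNr additive_map0. Qed.

Lemma additive_map_sum (I : Type) (r : seq I) (f : I -> V) :
  d (\sum_(l <- r) f l) = \sum_(l <- r) d (f l).
Proof. by elim/big_rec2: _ => [|l y1 y2 _ <-]; rewrite ?additive_map0 ?dD. Qed.

End AdditiveMap.

Section SlotAction.
Variables (A : comPzRingType) (n : nat).
Implicit Types (w m : 'I_n -> 'I_n -> A) (s t u v : seq 'I_n).
Implicit Types (T : seq 'I_n -> A) (x : A).

Lemma sum_delta (I : finType) (i : I) (f : I -> A) :
  \sum_c (c == i)%:R * f c = f i.
Proof.
rewrite (bigD1 i) //= eqxx mul1r big1 ?addr0 // => c /negPf ->.
by rewrite mul0r.
Qed.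

(* Tensor fields are given by their components, as functions of the word of   *)
(* indices.  [slot_act w] is the derivation of the tensor algebra induced by  *)
(* the matrix w: it applies w to each slot in turn.                           *)
Fixpoint slot_act w s T : A :=
  if s is a :: s' then
    \sum_c w a c * T (c :: s') + slot_act w s' (fun t => T (a :: t))
  else 0.

Lemma eq_slot_act w w' s T T' :
  (forall a c, w a c = w' a c) ->
  (forall t, size t = size s -> T t = T' t) ->
  slot_act w s T = slot_act w' s T'.
Proof.
move=> ww; elim: s T T' => //= a s IH T T' TT; congr (_ + _).
  by apply: eq_bigr => c _; rewrite ww TT.
by apply: IH => t st; rewrite TT //= st.
Qed.

Lemma actDr w s T T' :
  slot_act w s (fun t => T t + T' t) = slot_act w s T + slot_act w s T'.
Proof.
elim: s T T' => [|a s IH] T T' /=; first by rewrite addr0.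
rewrite IH addrACA -big_split /=; congr (_ + _).
by apply: eq_bigr => c _; rewrite mulrDr.
Qed.

Lemma actZr w s x T : slot_act w s (fun t => x * T t) = x * slot_act w s T.
Proof.
elim: s T => [|a s IH] T /=; first by rewrite mulr0.
rewrite IH mulrDr mulr_sumr; congr (_ + _).
by apply: eq_bigr => c _; rewrite mulrCA.
Qed.

Lemma actNr w s T : slot_act w s (fun t => - T t) = - slot_act w s T.
Proof.
rewrite -mulN1r -actZr; apply: eq_slot_act => // t _; by rewrite mulN1r.
Qed.

Lemma actBr w s T T' :
  slot_act w s (fun t => T t - T' t) = slot_act w s T - slot_act w s T'.
Proof. by rewrite actDr actNr. Qed.

Lemma act0r w s : slot_act w s (fun=> 0) = 0.
Proof. by elim: s => //= a s ->; rewrite big1 ?addr0// => c _; rewrite mulr0. Qed.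


Lemma act_sumr (I : Type) (r : seq I) w s (T : I -> seq 'I_n -> A) :
  slot_act w s (fun t => \sum_(i <- r) T i t) = \sum_(i <- r) slot_act w s (T i).
Proof.
elim: r => [|i r IH].
  by rewrite big_nil -[RHS](act0r w s); apply: eq_slot_act => // t _; rewrite big_nil.
rewrite big_cons -IH -actDr; apply: eq_slot_act => // t _; by rewrite big_cons.
Qed.

Lemma actDl w m s T :
  slot_act (fun a c => w a c + m a c) s T = slot_act w s T + slot_act m s T.
Proof.
elim: s T => [|a s IH] T /=; first by rewrite addr0.
rewrite IH addrACA -big_split /=; congr (_ + _).
by apply: eq_bigr => c _; rewrite mulrDl.
Qed.

Lemma actZl x w s T : slot_act (fun a c => x * w a c) s T = x * slot_act w s T.
Proof.
elim: s T => [|a s IH] T /=; first by rewrite mulr0.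
rewrite IH mulrDr mulr_sumr; congr (_ + _).
by apply: eq_bigr => c _; rewrite mulrA.
Qed.

Lemma actNl w s T : slot_act (fun a c => - w a c) s T = - slot_act w s T.
Proof.
rewrite -mulN1r -actZl; apply: eq_slot_act => // a c; by rewrite mulN1r.
Qed.

Lemma actBl w m s T :
  slot_act (fun a c => w a c - m a c) s T = slot_act w s T - slot_act m s T.
Proof. by rewrite actDl actNl. Qed.

Lemma act_suml (I : Type) (r : seq I) (w : I -> 'I_n -> 'I_n -> A) s T :
  slot_act (fun a c => \sum_(i <- r) w i a c) s T = \sum_(i <- r) slot_act (w i) s T.
Proof.
elim: r => [|i r IH].
  rewrite big_nil -[RHS](mul0r (slot_act (fun _ _ => 0) s T)) -actZl.
  by apply: eq_slot_act => // a c; rewrite big_nil mul0r.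
rewrite big_cons -IH -actDl; apply: eq_slot_act => // a c; by rewrite big_cons.
Qed.

Lemma act_cat w u v T :
  slot_act w (u ++ v) T = slot_act w u (fun t => T (t ++ v)) + slot_act w v (fun t => T (u ++ t)).
Proof.
elim: u T => [|a u IH] T /=; first by rewrite add0r.
by rewrite IH addrA.
Qed.

Lemma act_exchange w m u v (T : seq 'I_n -> seq 'I_n -> A) :
  slot_act w u (fun r => slot_act m v (fun t => T r t)) =
  slot_act m v (fun t => slot_act w u (fun r => T r t)).
Proof.
elim: u T => [|a u IH] T /=; first by rewrite act0r.
rewrite actDr act_sumr IH; congr (_ + _).
by apply: eq_bigr => c _; rewrite actZr.
Qed.

(** Actions on different slots commute, so only the terms in which both matrices hit the same slot
    survive; there they compose to the matrix commutator. *)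
Lemma act_comm w m s T :
  slot_act w s (fun t => slot_act m t T) - slot_act m s (fun t => slot_act w t T) =
  slot_act (fun a d => \sum_c (w a c * m c d - m a c * w c d)) s T.
Proof.
elim: s T => [|a s IH] T /=; first by rewrite subr0.
rewrite -IH !actDr !act_sumr.
under [X in _ + (X + _) - _]eq_bigr do rewrite actZr.
under [X in _ - (_ + (X + _))]eq_bigr do rewrite actZr.
under [X in X + _ - _]eq_bigr do rewrite mulrDr.
under [X in _ - (X + _)]eq_bigr do rewrite mulrDr.
rewrite !big_split /=.
under [X in _ = X + _]eq_bigr do rewrite big_distrl.
rewrite [X in _ = X + _]exchange_big /=.
have -> : \sum_j \sum_i (w a j * m j i - m a j * w j i) * T (i :: s) =
   \sum_c w a c * (\sum_d m c d * T (d :: s)) -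
   \sum_c m a c * (\sum_d w c d * T (d :: s)).
  rewrite -sumrB; apply: eq_bigr => c _; rewrite !mulr_sumr -sumrB.
  by apply: eq_bigr => d _; ring.
by ring.
Qed.

End SlotAction.

(* Curvature 1: R(e_x, e_y) e_a = \sum_c plane_rot x y a c e_c.                *)
Definition plane_rot (A : comPzRingType) n (x y a c : 'I_n) : A :=
  (a == y)%:R * (c == x)%:R - (a == x)%:R * (c == y)%:R.

(* Calculus in a moving orthonormal frame e_0, ..., e_(n-1) of a space of      *)
(* constant curvature K: der i is the derivative along e_i, conn i j c is the *)
(* coefficient of e_c in nabla_{e_i} e_j, and hess [:: i1; ...; im] is        *)
(* (nabla^m f)(e_i1, ..., e_im).                                              *)
Record frame_calculus (C : fieldType) (n : nat) (K lam : C) := FrameCalculus {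
  fring : comPzRingType;
  scal : {rmorphism C -> fring};
  der : 'I_n -> fring -> fring;
  derD : forall i a b, der i (a + b) = der i a + der i b;
  derM : forall i a b, der i (a * b) = der i a * b + a * der i b;
  der_scal : forall i c, der i (scal c) = 0;
  conn : 'I_n -> 'I_n -> 'I_n -> fring;
  conn_anti : forall i a c, conn i a c = - conn i c a;
  der_bracket : forall i j a, der i (der j a) - der j (der i a) =
    \sum_c (conn i j c - conn j i c) * der c a;
  conn_curvature : forall i j a b,
    der i (conn j a b) - der j (conn i a b)
    - \sum_c (conn i a c * conn j c b - conn j a c * conn i c b)
    - \sum_c (conn i j c - conn j i c) * conn c a b
    = scal K * plane_rot fring i j a b;
  hess : seq 'I_n -> fring;
  hess_cons : forall i s,
    hess (i :: s) = der i (hess s) - slot_act (conn i) s hess;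
  hess_laplacian : \sum_a hess [:: a; a] = - scal lam * hess [::]
}.

(** * The Ricci identity and the parallel trace *)

Section FrameCalculus.
Variables (C : fieldType) (n : nat) (K lam : C) (Y : frame_calculus n K lam).
Local Notation A := (fring Y).
Local Notation F := (@hess _ _ _ _ Y).
Implicit Types (i j k a b c : 'I_n) (x : A) (m : 'I_n -> 'I_n -> A).

Lemma der0 i : der i (0 : A) = 0.
Proof. exact: additive_map0 (derD i). Qed.

Lemma derN i x : der i (- x) = - der i x.
Proof. exact: additive_mapN (derD i) x. Qed.

Lemma derB i x y : der i (x - y) = der i x - der i y.
Proof. by rewrite derD derN. Qed.

Lemma der_sum (I : Type) (r : seq I) i (f : I -> A) :
  der i (\sum_(l <- r) f l) = \sum_(l <- r) der i (f l).
Proof. exact: (additive_map_sum (@derD _ _ _ _ Y i)). Qed.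

Lemma der_scalM i (z : C) x : der i (scal Y z * x) = scal Y z * der i x.
Proof. by rewrite derM der_scal mul0r add0r. Qed.

Lemma der_nat i (b : bool) : der i (b%:R : A) = 0.
Proof.
case: b; last exact: der0.
by rewrite -(rmorph1 (scal Y)) der_scal.
Qed.

Lemma der_plane_rot i j k a b : der k (plane_rot A i j a b) = 0.
Proof. by rewrite derB !derM !der_nat !(mulr0, mul0r) addr0 subr0. Qed.

Lemma der_act i m s T :
  der i (slot_act m s T) =
  slot_act (fun a c => der i (m a c)) s T + slot_act m s (fun t => der i (T t)).
Proof.
elim: s T => [|a s IH] T /=; first by rewrite der0 addr0.
rewrite derD IH addrACA der_sum -big_split /=; congr (_ + _).
by apply: eq_bigr => c _; rewrite derM.
Qed.

(** Expanding both sides with [hess_cons], the second derivatives leave the bracket of the two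
    derivations and the slots of [v] leave derivatives and commutators of the connection forms;
    [conn_curvature] collects these into the curvature. The sign is that of the dual action on
    covariant tensors. *)
Lemma ricci_nil i j v :
  F (i :: j :: v) - F (j :: i :: v) = - scal Y K * slot_act (plane_rot A i j) v F.
Proof.
rewrite !hess_cons /=.
have E (l k : 'I_n) :
    slot_act (conn Y l) v (fun t => F (k :: t)) =
    slot_act (conn Y l) v (fun t => der k (F t)) -
    slot_act (conn Y l) v (fun t => slot_act (conn Y k) t F).
  rewrite -actBr; apply: eq_slot_act => // t _; by rewrite hess_cons.
rewrite !E !derB !der_act.
under eq_bigr do rewrite hess_cons mulrBr.
under [X in _ - (_ - (X + _))]eq_bigr do rewrite hess_cons mulrBr.
rewrite !sumrB.
have R : scal Y K * slot_act (plane_rot A i j) v F =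
    slot_act (fun a b => der i (conn Y j a b)) v F
    - slot_act (fun a b => der j (conn Y i a b)) v F
    - (slot_act (conn Y i) v (fun t => slot_act (conn Y j) t F)
       - slot_act (conn Y j) v (fun t => slot_act (conn Y i) t F))
    - (\sum_c conn Y i j c * slot_act (conn Y c) v F
       - \sum_c conn Y j i c * slot_act (conn Y c) v F).
  rewrite act_comm -actZl -!actBl.
  rewrite -sumrB.
  under [X in _ - X]eq_bigr do rewrite -mulrBl -actZl.
  rewrite -act_suml -actBl.
  by apply: eq_slot_act => // a b; rewrite -conn_curvature.
rewrite mulNr R.
have := der_bracket i j (F v).
under eq_bigr do rewrite mulrBl.
rewrite sumrB => B.
have -> : der i (der j (F v)) = der j (der i (F v)) +
  (\sum_c conn Y i j c * der c (F v) - \sum_c conn Y j i c * der c (F v)).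
  by rewrite -B; ring.
by ring.
Qed.

(* The curvature tensor is parallel. *)
Lemma plane_rot_invariant k i j a d :
  \sum_c (plane_rot A i j a c * conn Y k c d - conn Y k a c * plane_rot A i j c d)
  = \sum_c conn Y k i c * plane_rot A c j a d
    + \sum_c conn Y k j c * plane_rot A i c a d.
Proof.
rewrite -big_split /= /plane_rot.
transitivity ((a == j)%:R * conn Y k i d - (a == i)%:R * conn Y k j d
   - (conn Y k a j * (d == i)%:R - conn Y k a i * (d == j)%:R)).
  rewrite -(sum_delta i (fun c => (a == j)%:R * conn Y k c d)).
  rewrite -(sum_delta j (fun c => (a == i)%:R * conn Y k c d)).
  rewrite -(sum_delta j (fun c => conn Y k a c * (d == i)%:R)).
  rewrite -(sum_delta i (fun c => conn Y k a c * (d == j)%:R)).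
  rewrite -!sumrB; apply: eq_bigr => c _; ring.
(* Metric compatibility turns the terms in which the connection acts on [a] into terms in which it
   acts on [i] or [j]. *)
rewrite (conn_anti Y k a j) (conn_anti Y k a i).
rewrite -(sum_delta d (fun c => (a == j)%:R * conn Y k i c)).
rewrite -(sum_delta d (fun c => (a == i)%:R * conn Y k j c)).
rewrite -(sum_delta a (fun c => - conn Y k j c * (d == i)%:R)).
rewrite -(sum_delta a (fun c => - conn Y k i c * (d == j)%:R)).
rewrite -!sumrB; apply: eq_bigr => c _.
rewrite (eq_sym d c) (eq_sym a c); ring.
Qed.

(* For a prefix u of derivatives, commuting them with the curvature only uses *)
(* that the curvature is parallel.                                            *)
Lemma ricci u i j v :
  F (u ++ i :: j :: v) - F (u ++ j :: i :: v) =
  - scal Y K * slot_act (plane_rot A i j) v (fun t => F (u ++ t)).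
Proof.
(* Induction on the length of the prefix, since the connection replaces [u] by other words of the
   same length. *)
have [l] := ubnP (size u); elim: l => // l IH in u i j v *.
case: u => [_|k u]; first exact: ricci_nil.
rewrite ltnS /= => ul; rewrite !hess_cons !act_cat /=.
pose T t := F (u ++ t); pose M := @plane_rot A n.
(* Moving the curvature past the derivative along [k]: the commutator with the connection on [v]
   becomes, by [plane_rot_invariant], the connection acting on [i] and [j], which is what [I4] and
   [I5] produce. *)
have E1 : slot_act (M i j) v (fun t => F (k :: u ++ t)) =
    slot_act (M i j) v (fun t => der k (T t))
    - slot_act (conn Y k) u (fun t => slot_act (M i j) v (fun r => F (t ++ r)))
    - slot_act (conn Y k) v (fun t => slot_act (M i j) t T)
    - (\sum_c conn Y k i c * slot_act (M c j) v T + \sum_c conn Y k j c * slot_act (M i c) v T).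
  under [X in _ = _ - (X + _)]eq_bigr do rewrite -actZl.
  under [X in _ = _ - (_ + X)]eq_bigr do rewrite -actZl.
  rewrite -!act_suml -actDl.
  have <- : slot_act (fun a d =>
      \sum_c (M i j a c * conn Y k c d - conn Y k a c * M i j c d)) v T =
    slot_act (fun a d => \sum_c conn Y k i c * M c j a d
                    + \sum_c conn Y k j c * M i c a d) v T.
    by apply: eq_slot_act => // a d; exact: plane_rot_invariant.
  rewrite -act_comm act_exchange.
  rewrite -addrA -opprD [X in _ - X](_ : _ =
    slot_act (M i j) v (fun t => slot_act (conn Y k) t T));
    last by rewrite addrC subrK.
  rewrite -!actBr; apply: eq_slot_act => // t _.
  by rewrite hess_cons act_cat -addrA -opprD.
have I1 : der k (F (u ++ i :: j :: v)) - der k (F (u ++ j :: i :: v)) =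
   - scal Y K * slot_act (M i j) v (fun t => der k (T t)).
  rewrite -derB IH // mulNr derN der_scalM der_act mulNr.
  rewrite [X in _ * (X + _)](_ : _ = 0) ?add0r //.
  rewrite -[RHS](mul0r (slot_act (fun _ _ => 0) v T)) -actZl.
  by apply: eq_slot_act => // a c; rewrite der_plane_rot mul0r.
have I2 : slot_act (conn Y k) u (fun t => F (t ++ i :: j :: v))
   - slot_act (conn Y k) u (fun t => F (t ++ j :: i :: v)) =
   - scal Y K * slot_act (conn Y k) u (fun t => slot_act (M i j) v (fun r => F (t ++ r))).
  rewrite -actBr -actZr; apply: eq_slot_act => // t st; by rewrite IH // st.
have I3 : slot_act (conn Y k) v (fun t => F (u ++ i :: j :: t))
   - slot_act (conn Y k) v (fun t => F (u ++ j :: i :: t)) =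
   - scal Y K * slot_act (conn Y k) v (fun t => slot_act (M i j) t T).
  rewrite -actBr -actZr; apply: eq_slot_act => // t st; by rewrite IH.
have I4 : \sum_c conn Y k i c * F (u ++ c :: j :: v) -
    \sum_c conn Y k i c * F (u ++ j :: c :: v) =
   - scal Y K * \sum_c conn Y k i c * slot_act (M c j) v T.
  rewrite -sumrB mulr_sumr; apply: eq_bigr => c _.
  by rewrite -mulrBr IH // mulrCA.
have I5 : \sum_c conn Y k j c * F (u ++ i :: c :: v) -
    \sum_c conn Y k j c * F (u ++ c :: i :: v) =
   - scal Y K * \sum_c conn Y k j c * slot_act (M i c) v T.
  rewrite -sumrB mulr_sumr; apply: eq_bigr => c _.
  by rewrite -mulrBr IH // mulrCA.
rewrite -/(M i j) E1 !mulrBr mulrDr -I1 -I2 -I3 -I4 -I5.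
by ring.
Qed.

(** The metric is parallel, so its trace commutes with every further derivative and the eigenvalue
    equation can be differentiated. *)
Lemma trace_tail v :
  \sum_a F (v ++ [:: a; a]) = - scal Y lam * F v.
Proof.
have [l] := ubnP (size v); elim: l => // l IH in v *.
case: v => [_|k v]; first exact: hess_laplacian.
rewrite ltnS /= => vl.
under eq_bigr do rewrite hess_cons act_cat /= addr0 opprD addrA.
rewrite !sumrB -der_sum -act_sumr IH //.
have -> : slot_act (conn Y k) v (fun t => \sum_a F (t ++ [:: a; a])) =
    - scal Y lam * slot_act (conn Y k) v F.
  by rewrite -actZr; apply: eq_slot_act => // t st; rewrite IH // st.
rewrite big_split /= [X in _ - (X + _)]exchange_big /= -big_split /=.
(* The connection terms on the two traced slots cancel by antisymmetry. *)
rewrite [X in _ - X]big1 => [|a _]; last first.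
  rewrite -big_split /= big1 // => c _.
  by rewrite (conn_anti Y k c) mulNr addNr.
by rewrite hess_cons mulNr derN der_scalM; ring.
Qed.

End FrameCalculus.

(** * Contractions along paired words *)

Section PairedWords.
Variables (S : eqType).
Implicit Types (w u v : seq S) (x y z : S).

Definition paired_word w := forall z, (count_mem z w == 0)%N || (count_mem z w == 2)%N.

Lemma paired_perm u v : perm_eq u v -> paired_word u -> paired_word v.
Proof. by move=> /seq.permP uv gu z; rewrite -!uv. Qed.

Lemma paired_nil x v : paired_word (x :: x :: v) -> paired_word v /\ x \notin v.
Proof.
move=> g; have xv : x \notin v.
  by apply/count_memPn/eqP; have /= := g x; rewrite eqxx; lia.
split=> // z; have /= := g z.
have [<-|_] := eqVneq x z; last by [].
by rewrite (count_memPn xv).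
Qed.

Definition rename y b x := if x == y then b else x.

(** Exactly one [b] and one [y] remain in [v], so identifying the two letters yields a letter that
    occurs twice. *)
Lemma paired_rename b y v :
  b != y -> paired_word (b :: y :: v) ->
  paired_word (map (rename y b) v) /\ y \notin map (rename y b) v.
Proof.
move=> by_ g; split; last first.
  apply/mapP => -[x _]; rewrite /rename.
  have [_ yb|xy yx] := eqVneq x y; first by rewrite yb eqxx in by_.
  by rewrite yx eqxx in xy.
move=> z; rewrite count_map.
have [->|zb] := eqVneq z b; last have [->|zy] := eqVneq z y.
- have -> : count (preim (rename y b) (pred1 b)) v = (count_mem b v + count_mem y v)%N.
    rewrite -count_predUI [X in (_ + X)%N](_ : _ = 0)%N ?addn0; last first.
      apply/eqP; rewrite eqn0Ngt -has_count; apply/hasPn => x _ /=.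
      by apply/andP => -[/eqP -> /eqP E]; rewrite E eqxx in by_.
    apply: eq_count => x /=; rewrite /rename.
    by have [->|_] := eqVneq x y; rewrite ?eqxx ?orbT ?orbF.
  have /= := g b; have /= := g y; rewrite !eqxx (negPf by_) (eq_sym y) (negPf by_).
  by lia.
- rewrite (@eq_count _ _ pred0) ?count_pred0 // => x /=; rewrite /rename.
  by have [_|/negPf //] := eqVneq x y; rewrite (negPf by_).
have /= := g z; rewrite (eq_sym b) (negPf zb) (eq_sym y) (negPf zy) !add0n.
rewrite (@eq_count _ (preim (rename y b) (pred1 z)) (pred1 z)) // => x /=.
rewrite /rename; have [->|//] := eqVneq x y.
by rewrite (eq_sym b) (eq_sym y) (negPf zb) (negPf zy).
Qed.

End PairedWords.

Section Relabelling.
Variables (S : finType) (n : nat).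

Definition upd (r : {ffun S -> 'I_n}) (z : S) (a : 'I_n) : {ffun S -> 'I_n} :=
  [ffun y => if y == z then a else r y].

Lemma upd_id r z a : upd r z a z = a.
Proof. by rewrite ffunE eqxx. Qed.

Lemma map_upd r z a w : z \notin w -> map (upd r z a) w = map r w.
Proof.
move=> zw; apply/eq_in_map => y yw; rewrite ffunE.
by have [yz|//] := eqVneq y z; rewrite -yz yw in zw.
Qed.

(** Exchanging the value at [z] with the extra index is an involution, so a summation index can take
    over the role of a letter. *)
Lemma sum_upd (A : nmodType) z (f : {ffun S -> 'I_n} -> 'I_n -> A) :
  \sum_r \sum_a f (upd r z a) (r z) = \sum_r \sum_a f r a.
Proof.
rewrite !pair_bigA /=.
rewrite [RHS](reindex_inj (h := fun p => (upd p.1 z p.2, p.1 z))) //=.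
apply: inv_inj => -[r a] /=; rewrite upd_id; congr (_, _).
by apply/ffunP => y; rewrite !ffunE; case: eqP => [->|].
Qed.

End Relabelling.

(** * Full contractions and the induction on their length *)

Section Contraction.
Variables (C : fieldType) (n : nat) (K lam : C) (S : finType).
Hypothesis n_neq0 : n%:R != 0 :> C.
Local Notation calc := (frame_calculus n K lam).
Implicit Types (w u v : seq S) (x y z b : S).

(** The order of quantifiers matters: one constant for all calculi with the same [n], [K] and
    [lam]. *)
Definition eigen (f : forall Y : calc, fring Y) :=
  exists c : C, forall Y : calc, f Y = scal Y c * hess Y [::].

Lemma eigenZ c f : eigen f -> eigen (fun Y => scal Y c * f Y).
Proof. by case=> d fd; exists (c * d) => Y; rewrite fd rmorphM mulrA. Qed.

Lemma eigenD f g : eigen f -> eigen g -> eigen (fun Y => f Y + g Y).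
Proof.
by case=> c fc [d gd]; exists (c + d) => Y; rewrite fc gd rmorphD mulrDl.
Qed.

Lemma eq_eigen f g : (forall Y, f Y = g Y) -> eigen g -> eigen f.
Proof. by move=> fg [c gc]; exists c => Y; rewrite fg gc. Qed.

(** Removes the factor [n] contributed by a letter that has dropped out of a word. *)
Lemma eigen_divn f : eigen (fun Y => f Y *+ n) -> eigen f.
Proof.
case=> c fc; exists (n%:R^-1 * c) => Y.
rewrite rmorphM -mulrA -fc -(mulr_natl (f Y)) mulrA -(rmorph_nat (scal Y)) -rmorphM.
by rewrite mulVf // rmorph1 mul1r.
Qed.

(** The sum runs over the values of all letters of [S], so every letter absent from [w] multiplies
    the contraction by [n]. This keeps the alphabet fixed during the induction. *)
Definition contract w (Y : calc) := \sum_(r : {ffun S -> 'I_n}) hess Y (map r w).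

(* Every value of r y other than r b kills the summand, so summing freely over *)
(* r y multiplies the number of terms by n.                                   *)
Lemma contract_delta (Y : calc) b y w :
  b != y ->
  y \notin map (rename y b) w ->
  (\sum_(r : {ffun S -> 'I_n}) (r b == r y)%:R * hess Y (map r w)) *+ n =
  contract (map (rename y b) w) Y.
Proof.
move=> by_ yw.
pose f (r : {ffun S -> 'I_n}) a := (r b == a)%:R * hess Y (map r (map (rename y b) w)).
transitivity (\sum_(r : {ffun S -> 'I_n}) \sum_a f (upd r y a) (r y)).
  rewrite -sumrMnl; apply: eq_bigr => r _.
  rewrite (eq_bigr (fun=> (r b == r y)%:R * hess Y (map r w))).
    by rewrite sumr_const card_ord.
  move=> a _; rewrite /f map_upd // ffunE (negPf by_).
  have [rby|_] := eqVneq (r b) (r y); last by rewrite !mul0r.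
  congr (_ * hess Y _); rewrite -map_comp; apply: eq_map => x /=.
  by rewrite /rename; case: eqP => // ->.
rewrite sum_upd; apply: eq_bigr => r _; rewrite /f.
by under eq_bigr do rewrite eq_sym; rewrite sum_delta.
Qed.

(** On the right [z] is a free letter, which accounts for the factor [n] on the left; otherwise this
    is [trace_tail]. *)
Lemma contract_trace (Y : calc) v z : z \notin v ->
  contract (v ++ [:: z; z]) Y *+ n = - scal Y lam * contract v Y.
Proof.
move=> zv; pose f (r : {ffun S -> 'I_n}) a := hess Y (map r v ++ [:: a; a]).
rewrite mulr_sumr.
under [RHS]eq_bigr do rewrite -trace_tail.
rewrite -[RHS](sum_upd z f) -sumrMnl; apply: eq_bigr => r _.
rewrite (eq_bigr (fun=> hess Y (map r (v ++ [:: z; z])))).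
  by rewrite sumr_const card_ord.
by move=> a _; rewrite /f map_upd // map_cat.
Qed.

Section Step.
Variable k : nat.
Hypothesis IH : forall w, (size w < k)%N -> paired_word w -> eigen (contract w).

(** The delta either is 1, when the two letters coincide, or identifies their values, so that
    renaming [y] to [b] gives a shorter paired word. *)
Lemma delta_term b y w : (size w < k)%N -> paired_word (b :: y :: w) ->
  eigen (fun Y => \sum_(r : {ffun S -> 'I_n}) (r b == r y)%:R * hess Y (map r w)).
Proof.
move=> wk g; have [E|by_] := eqVneq b y.
  rewrite E in g *; have [gw _] := paired_nil g.
  apply: eq_eigen (IH wk gw) => Y; apply: eq_bigr => r _.
  by rewrite eqxx mul1r.
have [gw yw] := paired_rename by_ g.
apply: eigen_divn; apply: eq_eigen (IH _ gw) => [Y|]; last by rewrite size_map.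
exact: contract_delta.
Qed.

(** The rotation in the plane of [x] and [y] acting on the slot of a letter [b] puts [x] there with
    a delta between [b] and [y], minus the same with [x] and [y] exchanged. Both are delta terms;
    the induction runs through the slots of [v]. *)
Lemma curvature_term u x y v :
  (size (u ++ v) < k.-1)%N ->
  paired_word (u ++ x :: y :: v) ->
  eigen (fun Y => \sum_(r : {ffun S -> 'I_n}) slot_act (plane_rot (fring Y) (r x) (r y)) (map r v)
                       (fun t => hess Y (map r u ++ t))).
Proof.
elim: v u => [|b v IHv] u uvk g /=.
  by exists 0 => Y; rewrite rmorph0 mul0r big1.
pose P1 (Y : calc) := \sum_(r : {ffun S -> 'I_n}) (r b == r y)%:R * hess Y (map r (u ++ x :: v)).
pose P2 (Y : calc) := \sum_(r : {ffun S -> 'I_n}) (r b == r x)%:R * hess Y (map r (u ++ y :: v)).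
have e1 : eigen P1.
  apply: delta_term; first by move: uvk; rewrite !size_cat /=; lia.
  by apply: paired_perm g; apply/seq.permP => p; rewrite /= !count_cat /=; lia.
have e2 : eigen P2.
  apply: delta_term; first by move: uvk; rewrite !size_cat /=; lia.
  by apply: paired_perm g; apply/seq.permP => p; rewrite /= !count_cat /=; lia.
have e3 := IHv (rcons u b).
apply: eq_eigen (eigenD (eigenD e1 (eigenZ (-1) e2)) (e3 _ _)) => [Y||].
- rewrite /P1 /P2 rmorphN1 mulN1r -sumrB -big_split /=.
  apply: eq_bigr => r _; congr (_ + _); last first.
    by apply: eq_slot_act => // t _; rewrite map_rcons cat_rcons.
  rewrite /plane_rot !map_cat /=.
  rewrite -(sum_delta (r x) (fun c => (r b == r y)%:R * hess Y (map r u ++ c :: map r v))).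
  rewrite -(sum_delta (r y) (fun c => (r b == r x)%:R * hess Y (map r u ++ c :: map r v))).
  by rewrite -sumrB; apply: eq_bigr => c _; ring.
- by move: uvk; rewrite !size_cat size_rcons /=; lia.
- by apply: paired_perm g; apply/seq.permP => p; rewrite /= -cats1 !count_cat /=; lia.
Qed.

Lemma swap_letters u x y v :
  (size (u ++ x :: y :: v) <= k)%N -> paired_word (u ++ x :: y :: v) ->
  eigen (contract (u ++ y :: x :: v)) -> eigen (contract (u ++ x :: y :: v)).
Proof.
move=> uvk g e; have ec : eigen (fun Y => \sum_(r : {ffun S -> 'I_n})
    slot_act (plane_rot (fring Y) (r x) (r y)) (map r v)
      (fun t => hess Y (map r u ++ t))).
  by apply: curvature_term g => //; move: uvk; rewrite !size_cat /=; lia.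
apply: eq_eigen (eigenD e (eigenZ (- K) ec)) => Y.
rewrite /contract mulr_sumr -big_split /=; apply: eq_bigr => r _.
rewrite !map_cat /= rmorphN -ricci; ring.
Qed.

Lemma move_letter u x v v' :
  (size (u ++ x :: v ++ v') <= k)%N -> paired_word (u ++ x :: v ++ v') ->
  eigen (contract (u ++ v ++ x :: v')) -> eigen (contract (u ++ x :: v ++ v')).
Proof.
elim: v u => [|y v IHv] u //= uvk g e.
apply: swap_letters => //; rewrite -cat_rcons; apply: IHv.
- by move: uvk; rewrite !size_cat size_rcons /= size_cat; lia.
- by apply: paired_perm g; apply/seq.permP => p; rewrite /= -cats1 !count_cat /= !count_cat; lia.
- by rewrite cat_rcons.
Qed.

End Step.

Theorem paired_contraction w : paired_word w -> eigen (contract w).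
Proof.
have [k] := ubnP (size w); elim: k => // k IH in w *.
case: w => [_ _|z w].
  exists (#|{: {ffun S -> 'I_n}}|%:R) => Y.
  by rewrite /contract /= sumr_const rmorph_nat mulr_natl.
rewrite ltnS => wk g.
have zw : z \in w.
  rewrite -has_pred1 has_count.
  by have /= := g z; rewrite eqxx; lia.
have [u [v wE]] : exists u v : seq S, w = u ++ z :: v.
  by case/splitPr: zw => u v; exists u, v.
rewrite {}wE {w zw} in g wk *.
have IHs w' : (size w' < k)%N -> paired_word w' -> eigen (contract w') by move=> *; exact: IH.
have gp : paired_word (z :: z :: u ++ v).
  by apply: paired_perm g; apply/seq.permP => p; rewrite /= !count_cat /=; lia.
have [guv zuv] := paired_nil gp.
have skuv : size (z :: u ++ z :: v) = (size (u ++ v)).+2.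
  by rewrite /= !size_cat /=; lia.
(* The target form, with the pair [z] at the end: tracing it off leaves the shorter word
   [u ++ v]. *)
have e0 : eigen (contract ((u ++ v) ++ [:: z; z])).
  apply: eigen_divn; have [|c ec] := IHs (u ++ v) _ guv.
    by move: wk; rewrite skuv; lia.
  exists (- lam * c) => Y.
  by rewrite contract_trace // ec rmorphM rmorphN mulrA.
(* Back from the target to the given word, one occurrence of [z] at a time. *)
have e1 : eigen (contract (z :: u ++ v ++ [:: z])).
  have := @move_letter k IHs [::] z (u ++ v) [:: z]; rewrite /= -!catA; apply.
  - by move: wk; rewrite skuv !size_cat /=; lia.
  - by apply: paired_perm g; apply/seq.permP => p; rewrite /= !count_cat /= ?count_cat /=; lia.
  - by rewrite /= in e0; rewrite -!catA in e0.
have := @move_letter k IHs (z :: u) z v [::]; rewrite /= !cats0; apply=> //.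
Qed.

End Contraction.

(** * From coordinates to a moving frame *)

Section MovingFrame.
Variables (C : fieldType) (n : nat) (K lam : C) (A : comPzRingType).
Variables (cstA : {rmorphism C -> A}) (D : 'I_n -> A -> A).
Hypothesis DD : forall k x y, D k (x + y) = D k x + D k y.
Hypothesis DM : forall k x y, D k (x * y) = D k x * y + x * D k y.
Hypothesis Dcst : forall k c, D k (cstA c) = 0.
Hypothesis DC : forall k l x, D k (D l x) = D l (D k x).
Variables (g X : 'M[A]_n) (gam : 'I_n -> 'M[A]_n).
Implicit Types (M N : 'M[A]_n) (T : seq 'I_n -> A) (s t : seq 'I_n).

Definition dmx k M := map_mx (D k) M.
(** The rows of [X] are the frame vectors in coordinates; the entry at [k], [a] is
    $g(\partial_k,e_a)$. *)
Definition coframe := g *m X^T.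

Hypothesis g_sym : g^T = g.
Hypothesis XZ : X *m coframe = 1%:M.
Hypothesis ZX : coframe *m X = 1%:M.
Hypothesis gam_sym : forall k m l, gam k m l = gam m k l.
Hypothesis gam_metric : forall k, dmx k g = gam k *m g + g *m (gam k)^T.
Hypothesis gam_curv : forall i j,
  dmx i (gam j) - dmx j (gam i) + (gam j *m gam i - gam i *m gam j) =
  \matrix_(k, l) (cstA K * ((l == i)%:R * g j k - (l == j)%:R * g i k)).

(** The connection form of the frame: its entry at [a], [b] is $g(\nabla_{\partial_k}e_a,e_b)$,
    where [gam k m l] stands for $\Gamma^l_{km}$. *)
Definition frame_form k := (dmx k X + X *m gam k) *m coframe.

Lemma dmxD k M N : dmx k (M + N) = dmx k M + dmx k N.
Proof. by apply/matrixP => i j; rewrite !mxE DD. Qed.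

Lemma dmxM k M N : dmx k (M *m N) = dmx k M *m N + M *m dmx k N.
Proof.
apply/matrixP => i j; rewrite !mxE (additive_map_sum (DD _)) -big_split /=.
by apply: eq_bigr => l _; rewrite !mxE DM.
Qed.

Lemma dmxT k M : dmx k M^T = (dmx k M)^T.
Proof. by apply/matrixP => i j; rewrite !mxE. Qed.

Lemma dmxC k l M : dmx k (dmx l M) = dmx l (dmx k M).
Proof. by apply/matrixP => i j; rewrite !mxE DC. Qed.

Lemma dmx1 k : dmx k 1%:M = 0.
Proof.
apply/matrixP => i j; rewrite !mxE; case: (i == j); last exact: additive_map0 (DD k).
by rewrite -(rmorph1 cstA) Dcst.
Qed.

Lemma frame_form_X k : frame_form k *m X = dmx k X + X *m gam k.
Proof. by rewrite /frame_form -mulmxA ZX mulmx1. Qed.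

(** Differentiate $XgX^T=1$ and use metric compatibility. *)
Lemma frame_form_anti k : frame_form k = - (frame_form k)^T.
Proof.
apply/eqP; rewrite -addr_eq0; apply/eqP; have := dmx1 k.
rewrite -XZ dmxM /coframe dmxM gam_metric dmxT => <-.
have -> : (frame_form k)^T = X *m g *m ((dmx k X)^T + (gam k)^T *m X^T).
  by rewrite /frame_form /coframe !trmx_mul trmxK g_sym linearD /= trmx_mul.
rewrite /frame_form /coframe !(mulmxDl, mulmxDr) !mulmxA -!addrA.
by congr (_ + (_ + _)); rewrite addrC.
Qed.

(** Gauge covariance of curvature: the second derivatives of [X] cancel because partial derivatives
    commute, and what remains is conjugated by the frame. *)
Lemma frame_form_curv k l :
  dmx k (frame_form l) - dmx l (frame_form k)
  - (frame_form k *m frame_form l - frame_form l *m frame_form k) =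
  X *m (dmx k (gam l) - dmx l (gam k) + (gam l *m gam k - gam k *m gam l))
    *m coframe.
Proof.
rewrite -[LHS]mulmx1 -XZ mulmxA; congr (_ *m _).
have E i j : dmx i (frame_form j) *m X =
  dmx i (dmx j X) + (dmx i X *m gam j + X *m dmx i (gam j))
  - frame_form j *m dmx i X.
  apply/eqP; rewrite eq_sym subr_eq; apply/eqP.
  by rewrite -dmxM -dmxM -dmxD frame_form_X.
have E2 i j : frame_form i *m frame_form j *m X =
  frame_form i *m dmx j X + (dmx i X *m gam j + X *m gam i *m gam j).
  by rewrite -mulmxA frame_form_X mulmxDr mulmxA frame_form_X mulmxDl.
rewrite !mulmxBl !E !E2 (dmxC l k) mulmxDr !mulmxBr !mulmxA.
set a1 := frame_form l *m dmx k X; set a2 := frame_form k *m dmx l X.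
set b1 := dmx k X *m gam l; set b2 := dmx l X *m gam k.
set c1 := X *m gam l *m gam k; set c2 := X *m gam k *m gam l.
set d1 := X *m dmx k _; set d2 := X *m dmx l _.
set e := dmx l (dmx k X).
move: a1 a2 b1 b2 c1 c2 d1 d2 e => a1 a2 b1 b2 c1 c2 d1 d2 e.
apply/matrixP => i j; rewrite !mxE; ring.
Qed.

Definition form_curv i j :=
  dmx i (gam j) - dmx j (gam i) + (gam j *m gam i - gam i *m gam j).

(** The left side is the commutator of two partial derivatives applied to [g], rewritten by metric
    compatibility. *)
Lemma form_curv_anti i j : form_curv i j *m g + g *m (form_curv i j)^T = 0.
Proof.
transitivity (dmx i (dmx j g) - dmx j (dmx i g)); last by rewrite dmxC subrr.
have E k l : dmx k (dmx l g) = dmx k (gam l) *m g + gam l *m (gam k *m g)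
    + gam l *m g *m (gam k)^T + gam k *m g *m (gam l)^T
    + g *m ((gam k)^T *m (gam l)^T) + g *m (dmx k (gam l))^T.
  rewrite gam_metric dmxD !dmxM gam_metric dmxT mulmxDr mulmxDl !mulmxA.
  move: (dmx k _ *m g) (gam l *m gam k *m g) (_ *m (gam k)^T) (_ *m (gam l)^T) => *.
  by rewrite !addrA.
have -> : (form_curv i j)^T = (dmx i (gam j))^T - (dmx j (gam i))^T
    + ((gam i)^T *m (gam j)^T - (gam j)^T *m (gam i)^T).
  by rewrite -!trmx_mul; apply/matrixP => p q; rewrite !mxE.
rewrite !E /form_curv.
rewrite !(mulmxDl, mulmxDr, mulmxBl, mulmxBr, mulmxN, mulNmx) !mulmxA.
set a1 := dmx i (gam j) *m g; set a2 := dmx j (gam i) *m g.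
set b1 := gam j *m gam i *m g; set b2 := gam i *m gam j *m g.
set c1 := gam j *m g *m _; set c2 := gam i *m g *m _.
set d1 := g *m (gam i)^T *m _; set d2 := g *m (gam j)^T *m _.
set e1 := g *m (dmx i _)^T; set e2 := g *m (dmx j _)^T.
move: a1 a2 b1 b2 c1 c2 d1 d2 e1 e2 => *.
apply/matrixP => p q; rewrite !mxE; ring.
Qed.

Lemma form_curv_bianchi i j k l :
  form_curv i j k l + form_curv j k i l + form_curv k i j l = 0.
Proof.
rewrite /form_curv !mxE (gam_sym k j l) (gam_sym k i l) (gam_sym j i l).
have E (p q r r' : 'I_n) :
    \sum_m gam p q m * gam r m r' = \sum_m gam q p m * gam r m r'.
  by apply: eq_bigr => m _; rewrite gam_sym.
rewrite (E j k) (E k i) (E i j); ring.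
Qed.

Definition frame_der a x := \sum_k X a k * D k x.
Definition frame_conn a b c := \sum_k X a k * frame_form k b c.

(** Torsion-freeness in the frame: $\nabla_{e_i}e_j-\nabla_{e_j}e_i=[e_i,e_j]$, read in
    coordinates. *)
Lemma frame_bracket i j l :
  \sum_c (frame_conn i j c - frame_conn j i c) * X c l =
  frame_der i (X j l) - frame_der j (X i l).
Proof.
have E a b : \sum_c frame_conn a b c * X c l =
  frame_der a (X b l) + \sum_k \sum_m X a k * (X b m * gam k m l).
  transitivity (\sum_k X a k * (frame_form k *m X) b l).
    under eq_bigr do rewrite mulr_suml.
    rewrite exchange_big; apply: eq_bigr => k _; rewrite mxE mulr_sumr.
    by apply: eq_bigr => c _; rewrite mulrA.
  rewrite -big_split /=; apply: eq_bigr => k _.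
  by rewrite frame_form_X !mxE mulrDr mulr_sumr.
under eq_bigr do rewrite mulrBl.
rewrite sumrB !E exchange_big /= opprD addrACA [X in _ + X](_ : _ = 0) ?addr0 //.
apply/eqP; rewrite subr_eq0; apply/eqP.
apply: eq_bigr => k _; apply: eq_bigr => m _; rewrite gam_sym; ring.
Qed.

Lemma frame_derD i a b : frame_der i (a + b) = frame_der i a + frame_der i b.
Proof.
by rewrite -big_split /=; apply: eq_bigr => k _; rewrite DD mulrDr.
Qed.

Lemma frame_derM i a b : frame_der i (a * b) = frame_der i a * b + a * frame_der i b.
Proof.
rewrite mulr_suml mulr_sumr -big_split /=; apply: eq_bigr => k _.
by rewrite DM; ring.
Qed.

Lemma frame_der_cst i c : frame_der i (cstA c) = 0.
Proof. by rewrite /frame_der big1 // => k _; rewrite Dcst mulr0. Qed.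

Lemma frame_conn_anti i a c : frame_conn i a c = - frame_conn i c a.
Proof.
rewrite -sumrN; apply: eq_bigr => k _.
by rewrite {1}frame_form_anti !mxE mulrN.
Qed.

Lemma frame_der_bracket i j x :
  frame_der i (frame_der j x) - frame_der j (frame_der i x) =
  \sum_c (frame_conn i j c - frame_conn j i c) * frame_der c x.
Proof.
transitivity (\sum_l (frame_der i (X j l) - frame_der j (X i l)) * D l x); last first.
  under eq_bigr do rewrite -frame_bracket mulr_suml.
  rewrite exchange_big; apply: eq_bigr => c _; rewrite mulr_sumr.
  by apply: eq_bigr => l _; rewrite mulrA.
have E a b : frame_der a (frame_der b x) =
    \sum_l frame_der a (X b l) * D l x
    + \sum_l \sum_k X a k * (X b l * D k (D l x)).
  rewrite -big_split /= /frame_der.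
  under [LHS]eq_bigr do rewrite (additive_map_sum (DD _)) mulr_sumr.
  rewrite exchange_big; apply: eq_bigr => l _.
  rewrite mulr_suml -big_split; apply: eq_bigr => k _ /=.
  by rewrite DM; ring.
rewrite !E; under [RHS]eq_bigr do rewrite mulrBl.
rewrite sumrB [X in _ - (_ + X)]exchange_big /= opprD addrACA [X in _ + X](_ : _ = 0) ?addr0 //.
apply/eqP; rewrite subr_eq0; apply/eqP.
apply: eq_bigr => k _; apply: eq_bigr => m _; rewrite DC; ring.
Qed.

(** The terms that differentiate the coefficients of [X] add up to the bracket of the frame fields
    and cancel the bracket term. The rest is tensorial, namely the curvature of [frame_form]
    evaluated on two frame vectors. *)
Lemma frame_conn_curvature i j a b :
  frame_der i (frame_conn j a b) - frame_der j (frame_conn i a b)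
  - \sum_c (frame_conn i a c * frame_conn j c b - frame_conn j a c * frame_conn i c b)
  - \sum_c (frame_conn i j c - frame_conn j i c) * frame_conn c a b
  = cstA K * plane_rot A i j a b.
Proof.
have E p q : frame_der p (frame_conn q a b) =
  \sum_l frame_der p (X q l) * frame_form l a b
  + \sum_l \sum_k X p k * (X q l * dmx k (frame_form l) a b).
  rewrite -big_split /= /frame_der /frame_conn.
  under [LHS]eq_bigr do rewrite (additive_map_sum (DD _)) mulr_sumr.
  rewrite exchange_big; apply: eq_bigr => l _.
  rewrite mulr_suml -big_split; apply: eq_bigr => k _ /=.
  by rewrite DM !mxE; ring.
have E2 : \sum_c (frame_conn i j c - frame_conn j i c) * frame_conn c a b =
  \sum_l frame_der i (X j l) * frame_form l a b - \sum_l frame_der j (X i l) * frame_form l a b.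
  rewrite -sumrB; under [RHS]eq_bigr do rewrite -mulrBl -frame_bracket mulr_suml.
  rewrite exchange_big; apply: eq_bigr => c _; rewrite mulr_sumr.
  by apply: eq_bigr => l _; rewrite mulrA.
have E3 p q : \sum_c frame_conn p a c * frame_conn q c b =
  \sum_k \sum_l X p k * (X q l * (frame_form k *m frame_form l) a b).
  under eq_bigr do rewrite mulr_suml.
  rewrite exchange_big; apply: eq_bigr => k _.
  under eq_bigr do rewrite mulr_sumr.
  rewrite exchange_big; apply: eq_bigr => l _; rewrite mxE !mulr_sumr.
  by apply: eq_bigr => c _; ring.
transitivity (\sum_k \sum_l X i k * (X j l *
   (dmx k (frame_form l) - dmx l (frame_form k)
    - (frame_form k *m frame_form l - frame_form l *m frame_form k)) a b)).
  have E1 : frame_der i (frame_conn j a b) =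
      \sum_l frame_der i (X j l) * frame_form l a b
      + \sum_k \sum_l X i k * (X j l * dmx k (frame_form l) a b).
    by rewrite E; congr (_ + _); rewrite exchange_big.
  have E3' : \sum_c frame_conn j a c * frame_conn i c b =
      \sum_k \sum_l X j l * (X i k * (frame_form l *m frame_form k) a b).
    by rewrite E3 exchange_big.
  rewrite E1 E E2 sumrB E3 E3'.
  set S1 := \sum_l _ * _; set S2 := \sum_l _ * _.
  transitivity (\sum_k \sum_l X i k * (X j l * dmx k (frame_form l) a b)
    - \sum_k \sum_l X j l * (X i k * dmx l (frame_form k) a b)
    - (\sum_k \sum_l X i k * (X j l * (frame_form k *m frame_form l) a b)
    - \sum_k \sum_l X j l * (X i k * (frame_form l *m frame_form k) a b))).
    by ring.
  rewrite -!sumrB; apply: eq_bigr => k _; rewrite -!sumrB; apply: eq_bigr => l _.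
  by rewrite !mxE; ring.
under eq_bigr do under eq_bigr do rewrite frame_form_curv gam_curv.
have XZE p q : \sum_k X p k * coframe k q = (p == q)%:R.
  by have := congr1 (fun M : 'M[A]_n => M p q) XZ; rewrite !mxE.
pose P k l : 'M[A]_n :=
  \matrix_(p, q) (cstA K * ((q == k)%:R * g l p - (q == l)%:R * g k p)).
have PE k l : (X *m P k l *m coframe) a b =
    cstA K * (coframe l a * coframe k b - coframe k a * coframe l b).
  have XP q : (X *m P k l) a q = 
    (q == k)%:R * (cstA K * coframe l a) - (q == l)%:R * (cstA K * coframe k a).
    rewrite /coframe !mxE !mulr_sumr -sumrB; apply: eq_bigr => p _.
    by rewrite !mxE; ring.
  rewrite mxE; under eq_bigr do rewrite XP mulrBl -!mulrA.
  by rewrite sumrB !sum_delta; ring.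
transitivity (\sum_k \sum_l cstA K *
   ((X i k * coframe k b) * (X j l * coframe l a)
    - (X i k * coframe k a) * (X j l * coframe l b))).
  apply: eq_bigr => k _; apply: eq_bigr => l _; rewrite PE; ring.
under eq_bigr do rewrite -mulr_sumr sumrB -!mulr_sumr !XZE.
rewrite -mulr_sumr sumrB -!mulr_suml !XZE /plane_rot.
by rewrite (eq_sym i b) (eq_sym j b) (eq_sym i a) (eq_sym j a); ring.
Qed.

(** The value on the frame vectors named by [s] of the covariant tensor with coordinate components
    [T]. *)
Fixpoint frame_comp s T : A :=
  if s is a :: s' then \sum_k X a k * frame_comp s' (fun t => T (k :: t))
  else T [::].

Lemma eq_frame_comp s T T' :
  (forall t, size t = size s -> T t = T' t) -> frame_comp s T = frame_comp s T'.
Proof.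
elim: s T T' => [|a s IH] T T' TT /=; first by rewrite TT.
apply: eq_bigr => k _; congr (_ * _); apply: IH => t st.
by rewrite TT //= st.
Qed.

Lemma frame_compB s T T' :
  frame_comp s (fun t => T t - T' t) = frame_comp s T - frame_comp s T'.
Proof.
elim: s T T' => [|a s IH] T T' //=; rewrite -sumrB.
by apply: eq_bigr => k _; rewrite IH mulrBr.
Qed.

Lemma frame_comp_sum s (y : 'I_n -> A) (T : 'I_n -> seq 'I_n -> A) :
  frame_comp s (fun t => \sum_l y l * T l t) = \sum_l y l * frame_comp s (T l).
Proof.
elim: s T => [|a s IH] T //=.
under eq_bigr do rewrite IH mulr_sumr.
rewrite exchange_big; apply: eq_bigr => l _; rewrite mulr_sumr.
by apply: eq_bigr => k _; rewrite mulrCA.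
Qed.

(** Covariant differentiation commutes with the change of frame: the derivative of [X] is absorbed
    by [frame_form_X]. *)
Lemma frame_comp_covariant k s T :
  D k (frame_comp s T) - slot_act (frame_form k) s (fun t => frame_comp t T) =
  frame_comp s (fun t => D k (T t) - slot_act (gam k) t T).
Proof.
elim: s T => [|a s IH] T /=; first by rewrite subr0.
rewrite (additive_map_sum (DD _)) act_sumr.
under [X in _ - (_ + X)]eq_bigr do rewrite actZr.
have -> : \sum_c frame_form k a c * (\sum_l X c l * frame_comp s (fun t => T (l :: t)))
   = \sum_l (D k (X a l) + (X *m gam k) a l) * frame_comp s (fun t => T (l :: t)).
  under eq_bigr do rewrite mulr_sumr.
  rewrite exchange_big; apply: eq_bigr => l _ /=.
  have /(congr1 (fun M : 'M[A]_n => M a l)) := frame_form_X k.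
  rewrite !mxE => <-; rewrite mulr_suml.
  by apply: eq_bigr => c _; rewrite mulrA.
have E l : frame_comp s (fun t => D k (T (l :: t)) -
     (\sum_c gam k l c * T (c :: t) + slot_act (gam k) t (fun r => T (l :: r)))) =
   D k (frame_comp s (fun t => T (l :: t)))
   - slot_act (frame_form k) s (fun t => frame_comp t (fun r => T (l :: r)))
   - \sum_c gam k l c * frame_comp s (fun t => T (c :: t)).
  rewrite IH -frame_comp_sum -frame_compB; apply: eq_frame_comp => t _.
  by rewrite opprD addrA addrAC.
under [RHS]eq_bigr do rewrite E !mulrBr.
rewrite !sumrB.
have -> : \sum_l X a l * (\sum_c gam k l c * frame_comp s (fun t => T (c :: t))) =
  \sum_l (X *m gam k) a l * frame_comp s (fun t => T (l :: t)).
  under eq_bigr do rewrite mulr_sumr.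
  rewrite exchange_big; apply: eq_bigr => l _ /=; rewrite mxE mulr_suml.
  by apply: eq_bigr => c _; rewrite mulrA.
under [X in X - _ = _]eq_bigr do rewrite DM.
under [X in _ - (X + _) = _]eq_bigr do rewrite mulrDl.
by rewrite !big_split /=; ring.
Qed.

Variable N : seq 'I_n -> A.
Hypothesis N_cons : forall k s, N (k :: s) = D k (N s) - slot_act (gam k) s N.
Hypothesis N_laplacian :
  \sum_a frame_comp [:: a; a] N = - cstA lam * N [::].

Lemma frame_comp_cons a s :
  frame_comp (a :: s) N =
  frame_der a (frame_comp s N) - slot_act (frame_conn a) s (fun t => frame_comp t N).
Proof.
rewrite /frame_conn act_suml.
under [X in _ - X]eq_bigr do rewrite actZl.
rewrite -sumrB /=; apply: eq_bigr => k _; rewrite -mulrBr frame_comp_covariant.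
by congr (_ * _); apply: eq_frame_comp => t _; rewrite N_cons.
Qed.

Definition moving_frame_calculus : frame_calculus n K lam :=
  FrameCalculus frame_derD frame_derM frame_der_cst frame_conn_anti
    frame_der_bracket frame_conn_curvature frame_comp_cons N_laplacian.

End MovingFrame.

(** * Components indexed by words and by finite functions *)

Section FrameComponents.
Variables (A : comPzRingType) (n : nat).

Definition ffun_cons m (p : 'I_n * {ffun 'I_m -> 'I_n}) : {ffun 'I_m.+1 -> 'I_n} :=
  [ffun b => if unlift ord0 b is Some b' then p.2 b' else p.1].

Lemma sum_ffun_cons m (B : nmodType) (f : {ffun 'I_m.+1 -> 'I_n} -> B) :
  \sum_j f j = \sum_k \sum_j f (ffun_cons (k, j)).
Proof.
rewrite pair_bigA /=.
pose tl (j : {ffun 'I_m.+1 -> 'I_n}) := (j ord0, [ffun b => j (lift ord0 b)]).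
rewrite (reindex (@ffun_cons m)) /=; first by apply: eq_bigr => -[].
exists tl => [[k j] _|j _].
  congr (_, _); first by rewrite ffunE unlift_none.
  by apply/ffunP => b; rewrite !ffunE liftK.
apply/ffunP => b; rewrite ffunE; case: unliftP => [b' ->|->] //=.
by rewrite ffunE.
Qed.

Lemma frame_comp_sum_ffun (X : 'M[A]_n) m (w : 'I_m -> 'I_n) (T : seq 'I_n -> A) :
  frame_comp X (map w (enum 'I_m)) T =
  \sum_(j : {ffun 'I_m -> 'I_n}) (\prod_b X (w b) (j b)) * T (map j (enum 'I_m)).
Proof.
elim: m w T => [|m IH] w T.
  have -> : enum 'I_0 = [::] by apply: size0nil; rewrite size_enum_ord.
  rewrite (big_pred1 [ffun i : 'I_0 => False_rect _ (notF (ltn_ord i))]) => [|j] /=.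
    by rewrite big_ord0 mul1r.
  by apply/esym/eqP/ffunP => -[].
rewrite sum_ffun_cons enum_ordSl /=; apply: eq_bigr => k _.
rewrite -map_comp IH mulr_sumr; apply: eq_bigr => j _.
rewrite big_ord_recl mulrA ffunE unlift_none /=; congr (_ * _ * T (_ :: _)).
  by apply: eq_bigr => b _; rewrite ffunE liftK.
by rewrite -map_comp; apply: eq_map => b /=; rewrite ffunE liftK.
Qed.

End FrameComponents.

(** * Algebraic curvature forms and symmetry of mixed derivatives *)

(** Polarising the diagonal condition, with the help of the pair symmetry, makes [S] antisymmetric
    in its outer arguments too, hence totally antisymmetric. The Bianchi sum is then three times
    [S]. *)
Lemma curvature_form_eq0 (R : realFieldType) (V : zmodType)
    (S : V -> V -> V -> V -> R) :
  (forall u u' v w z, S (u + u') v w z = S u v w z + S u' v w z) ->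
  (forall u v w z, S u v w z = - S v u w z) ->
  (forall u v w z, S u v w z = - S u v z w) ->
  (forall u v w z, S u v w z + S v w u z + S w u v z = 0) ->
  (forall u v, S u v v u = 0) ->
  forall u v w z, S u v w z = 0.
Proof.
move=> add1 a12 a34 bianchi diag.
have pair u v w z : S u v w z = S w z u v.
  have := bianchi u v w z; have := bianchi v w z u.
  have := bianchi w z u v; have := bianchi z u v w.
  have := a12 w u v z; have := a34 w u v z; have := a34 u v w z.
  have := a34 v w u z; have := a34 w z u v; have := a34 z v w u; have := a34 z u v w.
  have := a12 z u v w; have := a12 u w z v.
  have := a12 w z u v; have := a34 z w u v.
  have := a12 v z w u; have := a34 v z w u; have := a34 w u z v.
  have := a12 u v w z; have := a12 u v z w; have := a12 z v u w; have := a12 w z v u.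
  have := a12 z v w u.
  lra.
have add4 u v w z z' : S u v w (z + z') = S u v w z + S u v w z'.
  by rewrite (pair u v w (z + z')) a12 add1 opprD -!a12 !(pair _ v) -!(pair u v).
have add2 u v v' w z : S u (v + v') w z = S u v w z + S u v' w z.
  by rewrite a12 add1 opprD -!a12.
have add3 u v w w' z : S u v (w + w') z = S u v w z + S u v w' z.
  by rewrite a34 add4 opprD -!a34.
have p1 u v w : S u v w u + S u w v u = 0.
  have := diag u (v + w); rewrite add2 !add3 !diag; lra.
have p2 u v w : S u v w u = 0.
  have := p1 u v w; have := pair u v w u; have := a12 w u u v; have := a34 u w u v.
  lra.
have p3 u v w z : S u v w z = - S z v w u.
  by have := p2 (u + z) v w; rewrite add1 !add4 !p2; lra.
move=> u v w z.
have := bianchi u v w z.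
have := p3 u v w z; have := p3 v w u z; have := p3 w u v z.
have := pair z v w u; have := a12 w u z v; have := a34 u w z v.
have := pair z w u v; have := a12 u v z w; have := a34 v u z w; have := a34 u v z w.
have := pair z u v w; have := a12 v w z u; have := a34 w v z u.
have := a12 u v w z; have := a12 u w v z; have := a12 v w u z.
lra.
Qed.

Lemma not_close_to_both (R : realFieldType) (a b p : R) :
  `|a - p| < `|a - b| / 2 -> `|p - b| < `|a - b| / 2 -> False.
Proof. have := ler_distD p a b; lra. Qed.

(** * Symmetry of second directional derivatives *)

Section MixedDerivatives.
Variables (R : realType) (V : normedModType R).
Implicit Types (h : V -> R) (x u v : V).

Lemma is_derive_line h x u (s : R) : derivable h (x + s *: u) u ->
  is_derive s 1 (fun t : R => h (x + t *: u)) ('D_u h (x + s *: u)).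
Proof.
move=> hu.
have E2 : (fun t : R =>
      t^-1 *: (((fun t : R => h (x + t *: u)) \o shift s) (t *: 1)
               - h (x + s *: u))) =
         (fun t : R => t^-1 *: ((h \o shift (x + s *: u)) (t *: u) - h (x + s *: u))).
  apply/funext => t /=; congr (_ *: (h _ - _)).
  have -> : t *: (1 : R) = t by exact: mulr1.
  by rewrite scalerDl addrCA.
by split; rewrite ?/derivable ?/derive E2.
Qed.

Lemma line_mean_value h x u (d : R) : 0 < d ->
  (forall s, s \in `[0, d]%R -> derivable h (x + s *: u) u) ->
  exists2 s, s \in `[0, d]%R & h (x + d *: u) - h x = 'D_u h (x + s *: u) * d.
Proof.
move=> d0 hu.
have [||s s0d] := @MVT_segment R (fun t : R => h (x + t *: u))
    (fun s => 'D_u h (x + s *: u)) 0 d (ltW d0).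
- by move=> s s0d; apply/is_derive_line/hu; exact: subset_itv_oo_cc s0d.
- apply: derivable_within_continuous => s s0d.
  by have [] := is_derive_line (hu s s0d).
- by rewrite scale0r addr0 subr0 => e; exists s.
Qed.

Lemma derivable_shift h x u w : derivable h (x + w) u ->
  derivable (fun y => h (y + w)) x u /\ 'D_u (fun y => h (y + w)) x = 'D_u h (x + w).
Proof.
have E : (fun t : R => t^-1 *: (((fun y => h (y + w)) \o shift x) (t *: u) - h (x + w))) =
  (fun t : R => t^-1 *: ((h \o shift (x + w)) (t *: u) - h (x + w))).
  by apply/funext => t /=; rewrite addrA.
by rewrite /derivable /derive E.
Qed.

(** The mean value theorem is applied along [u] to the increment of [h] in direction [v], then along
    [v] to the derivative of [h] along [u]. *)
Lemma second_difference h x u v (d r : R) : 0 < d ->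
  d * (`|u| + `|v|) < r ->
  (forall y, `|y| < r ->
    derivable h (x + y) u /\ derivable ('D_u h) (x + y) v) ->
  exists2 y, `|y| < r &
    h (x + d *: u + d *: v) - h (x + d *: u) - (h (x + d *: v) - h x)
    = 'D_v ('D_u h) (x + y) * (d * d).
Proof.
move=> d0 dr hd.
have small s t : s \in `[0, d]%R -> t \in `[0, d]%R -> `|s *: u + t *: v| < r.
  rewrite !in_itv /= => /andP[s0 sd] /andP[t0 td].
  apply: le_lt_trans dr; apply: le_trans (ler_normD _ _) _.
  by rewrite !normrZ !ger0_norm // mulrDr lerD // ler_wpM2r.
have d1 : d \in `[0, d]%R by rewrite in_itv /= lexx ltW.
have d2 : 0 \in `[0, d]%R by rewrite in_itv /= lexx ltW.
pose k y := h (y + d *: v) - h y.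
have ku s : s \in `[0, d]%R -> derivable k (x + s *: u) u /\
    'D_u k (x + s *: u) = 'D_u h (x + s *: u + d *: v) - 'D_u h (x + s *: u).
  move=> sd.
  have [h1 _] : derivable h (x + (s *: u + d *: v)) u /\
      derivable ('D_u h) (x + (s *: u + d *: v)) v by apply: hd; exact: small.
  have [h2 _] : derivable h (x + (s *: u + 0 *: v)) u /\
      derivable ('D_u h) (x + (s *: u + 0 *: v)) v by apply: hd; exact: small.
  rewrite scale0r addr0 in h2; rewrite addrA in h1.
  have [h3 e] := derivable_shift h1.
  by split; [exact: (derivableB h3 h2)|rewrite /k (deriveB h3 h2) e].
have [s sd e] := line_mean_value d0 (fun s sd => (ku s sd).1).
have hv t : t \in `[0, d]%R -> derivable ('D_u h) (x + s *: u + t *: v) v.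
  by move=> td; rewrite -addrA; apply: (hd _ (small s t sd td)).2.
have [t td e2] := line_mean_value d0 hv.
exists (s *: u + t *: v); first exact: small.
by rewrite -/(k (x + d *: u)) -/(k x) e (ku s sd).2 e2 addrA mulrA.
Qed.

(** The second difference is symmetric in [u] and [v], so the two mixed derivatives share a value at
    points near [x]. If they differed at [x], continuity would put this value within half their
    distance of both. *)
Lemma derive_commute h x u v :
  (\forall y \near x, [/\ derivable h y u, derivable h y v,
     derivable ('D_u h) y v & derivable ('D_v h) y u]) ->
  {for x, continuous ('D_v ('D_u h))} -> {for x, continuous ('D_u ('D_v h))} ->
  'D_v ('D_u h) x = 'D_u ('D_v h) x.
Proof.
move=> hd cvu cuv; apply/eqP; rewrite -subr_eq0 -normr_le0 leNgt.
apply/negP => e0; set e := `|_| in e0.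
have e20 : 0 < e / 2 by rewrite divr_gt0.
have near1 : \forall y \near x, `|'D_v ('D_u h) x - 'D_v ('D_u h) y| < e / 2.
  by move/cvgrPdist_lt : cvu => /(_ _ e20).
have near2 : \forall y \near x, `|'D_u ('D_v h) x - 'D_u ('D_v h) y| < e / 2.
  by move/cvgrPdist_lt : cuv => /(_ _ e20).
have [r /= r0 rP] := (nbhs_ballP _ _).1 (filterI hd (filterI near1 near2)).
have xr y : `|y| < r -> ball x r (x + y).
  by move=> yr; rewrite -ball_normE /= opprD addNKr normrN.
(* The added 1 keeps the denominator positive and the inequality [dr] strict. *)
pose d := r / (`|u| + `|v| + 1).
have uv0 : 0 < `|u| + `|v| + 1 by rewrite ltr_wpDl// addr_ge0.
have d0 : 0 < d by rewrite divr_gt0.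
have dr : d * (`|u| + `|v|) < r.
  by rewrite /d mulrAC ltr_pdivrMr // ltr_pM2l // ltrDl.
have dr' : d * (`|v| + `|u|) < r by rewrite [`|v| + _]addrC.
have [y yr ey] := second_difference d0 dr (fun y yr =>
  let: conj (And4 a _ b _) _ := rP _ (xr y yr) in conj a b).
have [z zr ez] := second_difference d0 dr' (fun y yr =>
  let: conj (And4 _ a _ b) _ := rP _ (xr y yr) in conj a b).
have yz : 'D_v ('D_u h) (x + y) = 'D_u ('D_v h) (x + z).
  apply: (mulIf (x := d * d)); first by rewrite mulf_neq0 // gt_eqF.
  rewrite -[LHS]ey -[RHS]ez (addrAC x).
  move: (h _) (h _) (h _) (h x) => h1 h2 h3 h4; ring.
have [_ [n1 _]] := rP _ (xr y yr); have [_ [_ n2]] := rP _ (xr z zr).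
rewrite yz in n1; rewrite distrC in n2.
exact: not_close_to_both n1 n2.
Qed.

End MixedDerivatives.

(** * Smooth functions on an open set *)

Section SmoothFunctions.
Variables (R : realType) (n : nat) (D : set 'rV[R]_n).
Hypothesis openD : open D.
Implicit Types (f g h : 'rV[R]_n -> R) (x : 'rV[R]_n) (i : 'I_n).

(** Weaker than the usual class: continuity of the partial derivatives is only demanded by the next
    level of [Ck_on]. *)
Definition C1_on h := forall x, D x ->
  {for x, continuous h} /\ forall i, derivable h x (delta_mx 0 i).

Fixpoint Ck_on k h : Prop :=
  C1_on h /\ if k is k'.+1 then forall i, Ck_on k' (pd i h) else True.

(** [Ck_on] peels off the innermost derivative, whereas [foldr] exposes the outermost. Closure under
    sums and products then follows by induction from the Leibniz rule. *)
Lemma smooth_onP h : smooth_on D h <-> forall k, Ck_on k h.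
Proof.
split=> [hs k|hs s].
  elim: k h hs => [|k IH] h hs; split=> //; try by move=> x Dx; exact: (hs [::] x Dx).
  by move=> i; apply: IH => s x Dx; have := hs (rcons s i) x Dx; rewrite foldr_rcons.
elim/last_ind: s h hs => [|s i IH] h hs.
  by case: (hs 0%N).
rewrite foldr_rcons; apply: IH => k.
by case: (hs k.+1) => _; apply.
Qed.

Lemma eq_on_near f g x : (forall y, D y -> f y = g y) -> D x ->
  \forall y \near x, f y = g y.
Proof.
move=> fg Dx; have : nbhs x D by exact: open_nbhs_nbhs.
by apply: filterS => y /fg.
Qed.

Lemma eq_pd_on f g i : (forall y, D y -> f y = g y) ->
  forall x, D x -> pd i f x = pd i g x.
Proof. by move=> fg x Dx; apply: near_eq_derive; exact: eq_on_near. Qed.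

Lemma eq_C1_on f g : (forall y, D y -> f y = g y) -> C1_on f -> C1_on g.
Proof.
move=> fg fC x Dx; have [cf df] := fC x Dx; have nfg := eq_on_near fg Dx.
split=> [|i]; last exact: near_eq_derivable (df i).
rewrite /prop_for /continuous_at -(fg x Dx); apply: cvg_trans cf.
exact: (@near_eq_cvg _ _ (nbhs x) _ f g nfg).
Qed.

Lemma eq_Ck_on k f g : (forall y, D y -> f y = g y) -> Ck_on k f -> Ck_on k g.
Proof.
elim: k f g => [|k IH] f g fg [fC fk]; split.
- exact: eq_C1_on fC.
- by [].
- exact: eq_C1_on fC.
by move=> i; apply: IH (fk i); exact: eq_pd_on.
Qed.

Lemma Ck_onS k h : Ck_on k.+1 h -> Ck_on k h.
Proof.
elim: k h => [|k IH] h [hC hk]; split=> // i.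
exact: IH.
Qed.

Lemma C1D f g : C1_on f -> C1_on g -> C1_on (fun x => f x + g x).
Proof.
move=> fC gC x Dx; have [cf df] := fC x Dx; have [cg dg] := gC x Dx.
by split=> [|i]; [exact: continuousD|exact: (derivableD (df i) (dg i))].
Qed.

Lemma C1M f g : C1_on f -> C1_on g -> C1_on (fun x => f x * g x).
Proof.
move=> fC gC x Dx; have [cf df] := fC x Dx; have [cg dg] := gC x Dx.
by split=> [|i]; [exact: continuousM|exact: (derivableM (df i) (dg i))].
Qed.

Lemma C1_pdD f g i : C1_on f -> C1_on g -> forall x, D x ->
  pd i (fun y => f y + g y) x = pd i f x + pd i g x.
Proof.
move=> fC gC x Dx; have [_ df] := fC x Dx; have [_ dg] := gC x Dx.
exact: (deriveD (df i) (dg i)).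
Qed.

Lemma C1_pdM f g i : C1_on f -> C1_on g -> forall x, D x ->
  pd i (fun y => f y * g y) x = pd i f x * g x + f x * pd i g x.
Proof.
move=> fC gC x Dx; have [_ df] := fC x Dx; have [_ dg] := gC x Dx.
rewrite [LHS](deriveM (df i) (dg i)) addrC [g x *: _]mulrC.
by congr (_ + _).
Qed.

Lemma pd_cst (c : R) i x : pd i (fun=> c) x = 0.
Proof. exact: derive_cst. Qed.

Lemma Ck_onD k f g : Ck_on k f -> Ck_on k g -> Ck_on k (fun x => f x + g x).
Proof.
elim: k f g => [|k IH] f g [fC fk] [gC gk]; split;
  [exact: C1D|by []|exact: C1D|].
move=> i; apply: eq_Ck_on (IH _ _ (fk i) (gk i)) => x Dx.
by rewrite (C1_pdD i fC gC).
Qed.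

Lemma Ck_onM k f g : Ck_on k f -> Ck_on k g -> Ck_on k (fun x => f x * g x).
Proof.
elim: k f g => [|k IH] f g fk1 gk1; have [fC fk] := fk1; have [gC gk] := gk1;
  split; [exact: C1M|by []|exact: C1M|].
move=> i; have := Ck_onD (IH _ _ (fk i) (Ck_onS gk1)) (IH _ _ (Ck_onS fk1) (gk i)).
by apply: eq_Ck_on => x Dx; rewrite (C1_pdM i fC gC).
Qed.

Lemma Ck_on_cst k (c : R) : Ck_on k (fun=> c).
Proof.
elim: k c => [|k IH] c; split=> //;
  try by move=> x Dx; split=> [|i]; [exact: cst_continuous|exact: derivable_cst].
by move=> i; apply: eq_Ck_on (IH 0) => x Dx; rewrite pd_cst.
Qed.

Lemma smooth_on_C1 h : smooth_on D h -> C1_on h.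
Proof. by move=> hs x Dx; exact: (hs [::] x Dx). Qed.

Lemma eq_smooth_on f g :
  (forall y, D y -> f y = g y) -> smooth_on D f -> smooth_on D g.
Proof.
by move=> fg /smooth_onP fs; apply/smooth_onP => k; exact: eq_Ck_on (fs k).
Qed.

Lemma smooth_on_cst (c : R) : smooth_on D (fun=> c).
Proof. by apply/smooth_onP => k; exact: Ck_on_cst. Qed.

Lemma smooth_onD f g :
  smooth_on D f -> smooth_on D g -> smooth_on D (fun x => f x + g x).
Proof.
by move=> /smooth_onP fs /smooth_onP gs; apply/smooth_onP => k; exact: Ck_onD.
Qed.

Lemma smooth_onM f g :
  smooth_on D f -> smooth_on D g -> smooth_on D (fun x => f x * g x).
Proof.
by move=> /smooth_onP fs /smooth_onP gs; apply/smooth_onP => k; exact: Ck_onM.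
Qed.

Lemma smooth_onN f : smooth_on D f -> smooth_on D (fun x => - f x).
Proof.
move=> fs; apply: eq_smooth_on (smooth_onM (smooth_on_cst (-1)) fs) => x _.
by rewrite mulN1r.
Qed.

Lemma smooth_onB f g :
  smooth_on D f -> smooth_on D g -> smooth_on D (fun x => f x - g x).
Proof. by move=> fs gs; exact: (smooth_onD fs (smooth_onN gs)). Qed.

Lemma smooth_on_sum (I : Type) (r : seq I) (F : I -> 'rV[R]_n -> R) :
  (forall l, smooth_on D (F l)) -> smooth_on D (fun x => \sum_(l <- r) F l x).
Proof.
move=> Fs; elim: r => [|l r IH].
  by apply: eq_smooth_on (smooth_on_cst 0) => x _; rewrite big_nil.
by apply: eq_smooth_on (smooth_onD (Fs l) IH) => x _; rewrite big_cons.
Qed.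

Lemma smooth_on_pd f i : smooth_on D f -> smooth_on D (pd i f).
Proof. by move=> fs s x Dx; have := fs (rcons s i) x Dx; rewrite foldr_rcons. Qed.

Lemma pdN f i : smooth_on D f -> forall x, D x -> pd i (fun y => - f y) x = - pd i f x.
Proof.
move=> fs x Dx; have [_ df] := smooth_on_C1 fs Dx; exact: (deriveN (df i)).
Qed.

Lemma pd_commute f i j : smooth_on D f -> forall x, D x ->
  pd i (pd j f) x = pd j (pd i f) x.
Proof.
move=> fs x Dx; apply: derive_commute; last 2 first.
- by have [] := smooth_on_C1 (smooth_on_pd i (smooth_on_pd j fs)) Dx.
- by have [] := smooth_on_C1 (smooth_on_pd j (smooth_on_pd i fs)) Dx.
have : nbhs x D by exact: open_nbhs_nbhs.
apply: filterS => y Dy.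
have [_ df] := smooth_on_C1 fs Dy.
have [_ dfi] := smooth_on_C1 (smooth_on_pd i fs) Dy.
have [_ dfj] := smooth_on_C1 (smooth_on_pd j fs) Dy.
by split.
Qed.

End SmoothFunctions.

(** * Complex-valued smooth functions *)

Section ComplexSmooth.
Variables (R : realType) (n : nat) (D : set 'rV[R]_n).
Hypothesis openD : open D.

Definition extend (h : {x | D x} -> R[i]) (x : 'rV[R]_n) : R[i] :=
  if pselect (D x) is left Dx then h (exist _ x Dx) else 0.

Lemma extendE h x (Dx : D x) : extend h x = h (exist _ x Dx).
Proof.
rewrite /extend; case: pselect => // Dx'; congr (h (exist _ x _)).
exact: Prop_irrelevance.
Qed.

Lemma ReD (x y : R[i]) : complex.Re (x + y) = complex.Re x + complex.Re y.
Proof. by case: x y => a b [c d]. Qed.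
Lemma ImD (x y : R[i]) : complex.Im (x + y) = complex.Im x + complex.Im y.
Proof. by case: x y => a b [c d]. Qed.
Lemma ReN (x : R[i]) : complex.Re (- x) = - complex.Re x.
Proof. by case: x. Qed.
Lemma ImN (x : R[i]) : complex.Im (- x) = - complex.Im x.
Proof. by case: x. Qed.
Lemma ReM (x y : R[i]) :
  complex.Re (x * y) = complex.Re x * complex.Re y - complex.Im x * complex.Im y.
Proof. by case: x y => a b [c d]. Qed.
Lemma ImM (x y : R[i]) :
  complex.Im (x * y) = complex.Re x * complex.Im y + complex.Im x * complex.Re y.
Proof. by case: x y => a b [c d]. Qed.

Implicit Types (f g h : 'rV[R]_n -> R[i]).

Lemma eq_smoothC_on f g :
  (forall x, D x -> f x = g x) -> smoothC_on D f -> smoothC_on D g.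
Proof.
by move=> fg [fr fi]; split; [move: fr|move: fi]; apply: (eq_smooth_on openD) => x Dx;
  rewrite fg.
Qed.

Lemma smoothC_onD f g :
  smoothC_on D f -> smoothC_on D g -> smoothC_on D (fun x => f x + g x).
Proof.
move=> [fr fi] [gr gi]; split.
  by apply: (eq_smooth_on openD _ (smooth_onD openD fr gr)) => x _; rewrite ReD.
by apply: (eq_smooth_on openD _ (smooth_onD openD fi gi)) => x _; rewrite ImD.
Qed.

Lemma smoothC_onN f : smoothC_on D f -> smoothC_on D (fun x => - f x).
Proof.
move=> [fr fi]; split.
  by apply: (eq_smooth_on openD _ (smooth_onN openD fr)) => x _; rewrite ReN.
by apply: (eq_smooth_on openD _ (smooth_onN openD fi)) => x _; rewrite ImN.
Qed.

Lemma smoothC_onM f g :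
  smoothC_on D f -> smoothC_on D g -> smoothC_on D (fun x => f x * g x).
Proof.
move=> [fr fi] [gr gi]; split.
  have := smooth_onB openD (smooth_onM openD fr gr) (smooth_onM openD fi gi).
  by apply: (eq_smooth_on openD) => x _; rewrite ReM.
have := smooth_onD openD (smooth_onM openD fr gi) (smooth_onM openD fi gr).
by apply: (eq_smooth_on openD) => x _; rewrite ImM.
Qed.

Lemma smoothC_on_cst (c : R[i]) : smoothC_on D (fun=> c).
Proof. by split; apply: smooth_on_cst. Qed.

Lemma smoothC_on_real (h : 'rV[R]_n -> R) :
  smooth_on D h -> smoothC_on D (fun x => (h x)%:C).
Proof. by move=> hs; split; [exact: hs|exact: smooth_on_cst]. Qed.

Lemma smoothC_on_pdC f i : smoothC_on D f -> smoothC_on D (pdC i f).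
Proof. by case=> fr fi; split; exact: smooth_on_pd. Qed.

Lemma eq_pdC_on f g i : (forall x, D x -> f x = g x) ->
  forall x, D x -> pdC i f x = pdC i g x.
Proof.
move=> fg x Dx; rewrite /pdC; congr (_ +i* _);
  by apply: (eq_pd_on openD) => // y Dy; rewrite fg.
Qed.

Lemma eq_complex_ReIm (x y : R[i]) :
  complex.Re x = complex.Re y -> complex.Im x = complex.Im y -> x = y.
Proof. by case: x y => a b [c d] /= -> ->. Qed.

Lemma pdCD f g i : smoothC_on D f -> smoothC_on D g -> forall x, D x ->
  pdC i (fun y => f y + g y) x = pdC i f x + pdC i g x.
Proof.
move=> [/smooth_on_C1 fr /smooth_on_C1 fi] [/smooth_on_C1 gr /smooth_on_C1 gi] x Dx.
apply: eq_complex_ReIm; rewrite ?ReD ?ImD /=.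
  by rewrite -(C1_pdD i fr gr Dx); apply: (eq_pd_on openD) => // y _; rewrite ReD.
by rewrite -(C1_pdD i fi gi Dx); apply: (eq_pd_on openD) => // y _; rewrite ImD.
Qed.

Lemma pdCM f g i : smoothC_on D f -> smoothC_on D g -> forall x, D x ->
  pdC i (fun y => f y * g y) x = pdC i f x * g x + f x * pdC i g x.
Proof.
move=> [fr fi] [gr gi] x Dx.
have fr1 := smooth_on_C1 fr; have fi1 := smooth_on_C1 fi.
have gr1 := smooth_on_C1 gr; have gi1 := smooth_on_C1 gi.
apply: eq_complex_ReIm; rewrite ?ReD ?ImD ?ReM ?ImM /=.
  transitivity (pd i (fun y => complex.Re (f y) * complex.Re (g y) +
    (- (complex.Im (f y) * complex.Im (g y)))) x).
    by apply: (eq_pd_on openD) => // y _; rewrite ReM.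
  rewrite (C1_pdD i (C1M fr1 gr1) (smooth_on_C1 (smooth_onN openD (smooth_onM openD fi gi))) Dx).
  rewrite (pdN i (smooth_onM openD fi gi) Dx).
  rewrite (C1_pdM i fr1 gr1 Dx) (C1_pdM i fi1 gi1 Dx).
  move: (pd _ _ x) (pd _ _ x) (pd _ _ x) (pd _ _ x) => *; ring.
transitivity (pd i (fun y => complex.Re (f y) * complex.Im (g y) +
  complex.Im (f y) * complex.Re (g y)) x).
  by apply: (eq_pd_on openD) => // y _; rewrite ImM.
rewrite (C1_pdD i (C1M fr1 gi1) (C1M fi1 gr1) Dx).
rewrite (C1_pdM i fr1 gi1 Dx) (C1_pdM i fi1 gr1 Dx).
move: (pd _ _ x) (pd _ _ x) (pd _ _ x) (pd _ _ x) => *; ring.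
Qed.

Lemma pdC_commute f i j : smoothC_on D f -> forall x, D x ->
  pdC i (pdC j f) x = pdC j (pdC i f) x.
Proof.
by case=> fr fi x Dx; apply: eq_complex_ReIm; exact: (pd_commute openD).
Qed.

Lemma pdC_cst (c : R[i]) (i : 'I_n) x : pdC i (fun=> c) x = 0 :> R[i].
Proof. by rewrite /pdC !pd_cst. Qed.

Lemma pdC_real (h : 'rV[R]_n -> R) i x :
  pdC i (fun y => (h y)%:C) x = (pd i h x)%:C.
Proof. by rewrite /pdC /= pd_cst. Qed.

End ComplexSmooth.

(** * The differential ring of smooth functions on an open set *)

Section SmoothRing.
Variables (R : realType) (n : nat) (D : set 'rV[R]_n).

(** Elements are functions on the subtype, so that agreement on [D] is equality; the value 0 that
    [extend] takes elsewhere does not affect derivatives on the open set. *)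
Definition smooth_fun (oD : open D) : {pred ({x | D x} -> R[i])} :=
  fun F => `[< smoothC_on D (extend F) >].

Lemma smooth_fun_subring (oD : open D) : subring_closed (smooth_fun oD).
Proof.
split.
- apply/asboolP; apply: (eq_smoothC_on oD _ (smoothC_on_cst oD 1)) => x Dx.
  by rewrite extendE.
- move=> f g /asboolP fs /asboolP gs; apply/asboolP.
  apply: (eq_smoothC_on oD _ (smoothC_onD oD fs (smoothC_onN oD gs))) => x Dx.
  by rewrite !extendE.
move=> f g /asboolP fs /asboolP gs; apply/asboolP.
apply: (eq_smoothC_on oD _ (smoothC_onM oD fs gs)) => x Dx.
by rewrite !extendE.
Qed.

HB.instance Definition _ (oD : open D) :=
  GRing.isSubringClosed.Build ({x | D x} -> R[i]) (smooth_fun oD)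
    (smooth_fun_subring oD).

Record smoothRing (oD : open D) := SmoothRing {
  smooth_val : {x | D x} -> R[i];
  smooth_valP : smooth_val \in smooth_fun oD }.

HB.instance Definition _ (oD : open D) := [isSub for @smooth_val oD].
HB.instance Definition _ (oD : open D) := [Choice of smoothRing oD by <:].
HB.instance Definition _ (oD : open D) :=
  GRing.SubChoice_isSubComPzRing.Build _ _ (smoothRing oD)
    (GRing.subringClosedP _).

Hypothesis openD : open D.
Local Notation A := (smoothRing openD).
Implicit Types (a b : A) (f g : 'rV[R]_n -> R[i]).

Definition feval a : 'rV[R]_n -> R[i] := extend (smooth_val a).

Lemma smooth_eval a : smoothC_on D (feval a).
Proof. by have /asboolP := smooth_valP a. Qed.

Lemma eval_inj a b : (forall x, D x -> feval a x = feval b x) -> a = b.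
Proof.
move=> ab; apply: val_inj; apply/funext => -[x Dx] /=.
by have := ab x Dx; rewrite /feval !extendE.
Qed.

Lemma restrict_subproof f : smoothC_on D f ->
  (fun t : {x | D x} => f (sval t)) \in smooth_fun openD.
Proof.
move=> fs; apply/asboolP; apply: (eq_smoothC_on openD _ fs) => x Dx.
by rewrite extendE.
Qed.

Definition smooth_restrict f (fs : smoothC_on D f) : A :=
  SmoothRing (restrict_subproof fs).

Section Evaluation.
Variables (x : 'rV[R]_n) (Dx : D x).

Lemma eval_restrict f (fs : smoothC_on D f) : feval (smooth_restrict fs) x = f x.
Proof. by rewrite /feval extendE. Qed.

Lemma evalD a b : feval (a + b) x = feval a x + feval b x.
Proof. by rewrite /feval !extendE. Qed.

Lemma evalN a : feval (- a) x = - feval a x.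
Proof. by rewrite /feval !extendE. Qed.

Lemma evalM a b : feval (a * b) x = feval a x * feval b x.
Proof. by rewrite /feval !extendE. Qed.

Lemma eval0 : feval 0 x = 0.
Proof. by rewrite /feval !extendE. Qed.

Lemma eval1 : feval 1 x = 1.
Proof. by rewrite /feval !extendE. Qed.

Lemma eval_sum (I : Type) (r : seq I) (P : pred I) (F : I -> A) :
  feval (\sum_(i <- r | P i) F i) x = \sum_(i <- r | P i) feval (F i) x.
Proof.
by elim/big_rec2: _ => [|i y1 y2 _ <-]; rewrite ?eval0 ?evalD.
Qed.

Lemma eval_nat m : feval m%:R x = m%:R.
Proof. by elim: m => [|m IH]; rewrite ?eval0 // !mulrS evalD IH eval1. Qed.

End Evaluation.

Lemma eval_prod x (Dx : D x) (I : Type) (r : seq I) (P : pred I) (F : I -> A) :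
  feval (\prod_(i <- r | P i) F i) x = \prod_(i <- r | P i) feval (F i) x.
Proof.
by elim/big_rec2: _ => [|i y1 y2 _ <-]; rewrite ?(eval1 Dx) ?(evalM Dx).
Qed.

Definition smooth_cst (c : R[i]) : A := smooth_restrict (smoothC_on_cst openD c).

Lemma eval_cst c x (Dx : D x) : feval (smooth_cst c) x = c.
Proof. by rewrite eval_restrict. Qed.

Lemma smooth_cst_zmod_morphism : zmod_morphism smooth_cst.
Proof. by move=> c d; apply: eval_inj => x Dx; rewrite evalD // evalN // !eval_cst. Qed.

Lemma smooth_cst_monoid_morphism : monoid_morphism smooth_cst.
Proof.
split=> [|c d]; apply: eval_inj => x Dx.
  by rewrite eval1 // eval_cst.
by rewrite evalM // !eval_cst.
Qed.

HB.instance Definition _ :=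
  GRing.isZmodMorphism.Build R[i] A smooth_cst smooth_cst_zmod_morphism.
HB.instance Definition _ :=
  GRing.isMonoidMorphism.Build R[i] A smooth_cst smooth_cst_monoid_morphism.

Definition partial (k : 'I_n) a : A := smooth_restrict (smoothC_on_pdC k (smooth_eval a)).

Lemma eval_partial k a x : D x -> feval (partial k a) x = pdC k (feval a) x.
Proof. by move=> Dx; rewrite eval_restrict. Qed.

Lemma partial_restrict k f (fs : smoothC_on D f) x : D x ->
  feval (partial k (smooth_restrict fs)) x = pdC k f x.
Proof.
by move=> Dx; rewrite eval_partial //; apply: (eq_pdC_on openD) => // y Dy; rewrite eval_restrict.
Qed.

Lemma partialD k a b : partial k (a + b) = partial k a + partial k b.
Proof.
apply: eval_inj => x Dx; rewrite evalD // !eval_partial //.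
rewrite -(pdCD openD k (smooth_eval a) (smooth_eval b) Dx).
by apply: (eq_pdC_on openD) => // y Dy; rewrite evalD.
Qed.

Lemma partialM k a b : partial k (a * b) = partial k a * b + a * partial k b.
Proof.
apply: eval_inj => x Dx; rewrite evalD // !evalM // !eval_partial //.
rewrite -(pdCM openD k (smooth_eval a) (smooth_eval b) Dx).
by apply: (eq_pdC_on openD) => // y Dy; rewrite evalM.
Qed.

Lemma partial_cst k c : partial k (smooth_cst c) = 0.
Proof.
by apply: eval_inj => x Dx; rewrite partial_restrict // pdC_cst eval0.
Qed.

Lemma eval_partial2 k l a x : D x ->
  feval (partial k (partial l a)) x = pdC k (pdC l (feval a)) x.
Proof.
move=> Dx; rewrite eval_partial //; apply: (eq_pdC_on openD) => // y Dy.
exact: eval_partial.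
Qed.

Lemma partialC k l a : partial k (partial l a) = partial l (partial k a).
Proof.
apply: eval_inj => x Dx; rewrite (eval_partial2 k l a Dx) (eval_partial2 l k a Dx).
exact: (pdC_commute openD k l (smooth_eval a) Dx).
Qed.

End SmoothRing.

(** * Constant sectional curvature at a point *)

Section PointwiseCurvature.
Variables (R : realType) (n : nat) (G : 'rV[R]_n -> 'M[R]_n) (x : 'rV[R]_n).
Local Notation g := (G x).
Implicit Types (u v w z : 'rV[R]_n).

Definition curv_mx (i j : 'I_n) : 'M[R]_n := \matrix_(k, l) curvature G l k i j x.
(** The endomorphism $R(u,v)$, acting on row vectors from the right. *)
Definition curv_end u v : 'M[R]_n :=
  \sum_i \sum_j (u 0 i * v 0 j) *: curv_mx i j.

Hypothesis g_sym : g^T = g.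
Hypothesis g_pos : forall v, v != 0 -> 0 < (v *m g *m v^T) 0 0.

Lemma innerDl u u' v : inner g (u + u') v = inner g u v + inner g u' v.
Proof. by rewrite /inner !mulmxDl mxE. Qed.

Lemma innerZl c u v : inner g (c *: u) v = c * inner g u v.
Proof. by rewrite /inner -!scalemxAl mxE. Qed.

Lemma innerC u v : inner g u v = inner g v u.
Proof.
rewrite /inner; have -> : u *m g *m v^T = (v *m g *m u^T)^T.
  by rewrite !trmx_mul trmxK g_sym mulmxA.
by rewrite mxE.
Qed.

Lemma curvature_opE u v w : curvature_op G x u v w = w *m curv_end u v.
Proof.
apply/rowP => l; rewrite !mxE; under [RHS]eq_bigr do rewrite summxE mulr_sumr.
rewrite [RHS]exchange_big; apply: eq_bigr => i _ /=.
under [RHS]eq_bigr do rewrite summxE mulr_sumr.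
rewrite [RHS]exchange_big; apply: eq_bigr => j _ /=; apply: eq_bigr => k _.
by rewrite !mxE; move: (curvature _ _ _ _ _ _) => c; ring.
Qed.

Lemma curv_end_linear c u u' v :
  curv_end (c *: u + u') v = c *: curv_end u v + curv_end u' v.
Proof.
rewrite /curv_end scaler_sumr -big_split; apply: eq_bigr => i _ /=.
rewrite scaler_sumr -big_split; apply: eq_bigr => j _ /=.
by rewrite !mxE scalerA -scalerDl; congr (_ *: _); ring.
Qed.

Lemma curv_mxN i j : curv_mx i j = - curv_mx j i.
Proof.
apply/matrixP => k l; rewrite !mxE /curvature opprD opprB -sumrN.
by congr (_ + _); apply: eq_bigr => m _; rewrite opprB.
Qed.

Lemma curv_endN u v : curv_end u v = - curv_end v u.
Proof.
rewrite /curv_end exchange_big -sumrN; apply: eq_bigr => j _.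
rewrite -sumrN; apply: eq_bigr => i _.
by rewrite curv_mxN scalerN mulrC.
Qed.

Hypothesis curv_anti : forall i j, curv_mx i j *m g + g *m (curv_mx i j)^T = 0.
Hypothesis curv_bianchi : forall i j k l,
  curv_mx i j k l + curv_mx j k i l + curv_mx k i j l = 0.
Variable K : R.
Hypothesis curv_sectional : forall u v, row_free (col_mx u v) ->
  sectional G x u v = K.

Lemma curv_end_anti u v : curv_end u v *m g + g *m (curv_end u v)^T = 0.
Proof.
rewrite /curv_end linear_sum mulmx_suml mulmx_sumr -big_split big1 //= => i _.
rewrite linear_sum mulmx_suml mulmx_sumr -big_split big1 //= => j _.
by rewrite linearZ /= -scalemxAl -scalemxAr -scalerDr curv_anti scaler0.
Qed.

Lemma curv_end_bianchi u v w :
  w *m curv_end u v + u *m curv_end v w + v *m curv_end w u = 0.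
Proof.
have E a b c : c *m curv_end a b = \row_l \sum_i \sum_j \sum_k
    curv_mx i j k l * (a 0 i * b 0 j * c 0 k).
  rewrite -curvature_opE; apply/rowP => l; rewrite !mxE.
  apply: eq_bigr => i _; apply: eq_bigr => j _; apply: eq_bigr => k _.
  by rewrite mxE !mulrA.
rewrite !E; apply/rowP => l; rewrite !mxE.
have E2 : \sum_i \sum_j \sum_k curv_mx i j k l * (v 0 i * w 0 j * u 0 k) =
   \sum_i \sum_j \sum_k curv_mx j k i l * (u 0 i * v 0 j * w 0 k).
  under eq_bigr do rewrite exchange_big.
  rewrite exchange_big; apply: eq_bigr => i _; apply: eq_bigr => j _.
  by apply: eq_bigr => k _; ring.
have E3 : \sum_i \sum_j \sum_k curv_mx i j k l * (w 0 i * u 0 j * v 0 k) =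
   \sum_i \sum_j \sum_k curv_mx k i j l * (u 0 i * v 0 j * w 0 k).
  rewrite exchange_big; apply: eq_bigr => i _; rewrite exchange_big.
  by apply: eq_bigr => j _; apply: eq_bigr => k _; ring.
rewrite E2 E3 -!big_split big1 //= => i _; rewrite -!big_split big1 //= => j _.
rewrite -!big_split big1 //= => k _.
by rewrite -!mulrDl curv_bianchi mul0r.
Qed.

(** The difference between the curvature form and that of the model of curvature [K]; it inherits
    the curvature symmetries. *)
Definition curv_defect u v w z :=
  inner g (w *m curv_end u v) z
  - K * (inner g v w * inner g u z - inner g u w * inner g v z).

Lemma curv_defect_linear c u u' v w z :
  curv_defect (c *: u + u') v w z = c * curv_defect u v w z + curv_defect u' v w z.
Proof.
rewrite /curv_defect curv_end_linear mulmxDr -scalemxAr !innerDl !innerZl; ring.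
Qed.

Lemma curv_defect12 u v w z : curv_defect u v w z = - curv_defect v u w z.
Proof.
rewrite /curv_defect curv_endN mulmxN -scaleN1r innerZl; ring.
Qed.

Lemma curv_defect34 u v w z : curv_defect u v w z = - curv_defect u v z w.
Proof.
have E : inner g (w *m curv_end u v) z = - inner g (z *m curv_end u v) w.
  rewrite (innerC (z *m _)) /inner trmx_mul.
  have /eqP := curv_end_anti u v; rewrite addr_eq0 => /eqP E.
  by rewrite -!mulmxA (mulmxA _ g) E mulNmx mulmxN mxE -!mulmxA.
rewrite /curv_defect E; ring.
Qed.

Lemma curv_defect_bianchi u v w z :
  curv_defect u v w z + curv_defect v w u z + curv_defect w u v z = 0.
Proof.
have := congr1 (fun y => inner g y z) (curv_end_bianchi u v w).
rewrite !innerDl {4}/inner !mul0mx mxE => E.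
rewrite /curv_defect (innerC w u) (innerC v u) (innerC w v).
by rewrite -[RHS]E; ring.
Qed.

(** Strict Cauchy-Schwarz: up to the factor $g(u,u)$ this is the squared length of
    $g(u,u)v-g(u,v)u$, which is nonzero by independence. *)
Lemma gram_neq0 u v : row_free (col_mx u v) ->
  inner g u u * inner g v v - inner g u v ^+ 2 != 0.
Proof.
move=> uv; have inj := row_free_inj uv.
have u0 : u != 0.
  apply/eqP => u0; have : row_mx 1%:M 0 = 0 :> 'rV[R]_(1 + 1).
    by apply: inj; rewrite /= mul0mx mul_row_col mul1mx mul0mx addr0.
  move=> /(congr1 lsubmx); rewrite row_mxKl linear0 => /matrixP /(_ 0 0).
  by rewrite !mxE => /eqP; rewrite oner_eq0.
have uu : inner g u u != 0 by rewrite gt_eqF //; exact: g_pos.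
pose w := inner g u u *: v + (- inner g u v) *: u.
have w0 : w != 0.
  apply/eqP => w0.
  have : row_mx (- inner g u v)%:M (inner g u u)%:M = 0 :> 'rV[R]_(1 + 1).
    by apply: inj; rewrite /= mul0mx mul_row_col !mul_scalar_mx addrC.
  move=> /(congr1 rsubmx); rewrite row_mxKr linear0 => /matrixP /(_ 0 0).
  by rewrite !mxE => /eqP; rewrite mulr1n (negPf uu).
have ww : inner g w w = inner g u u * (inner g u u * inner g v v - inner g u v ^+ 2).
  rewrite /w innerDl !innerZl !(innerC _ (_ + _)) !innerDl !innerZl (innerC v u).
  ring.
have := g_pos w0; rewrite -/(inner g w w) ww => /gt_eqF.
by rewrite mulf_eq0 (negPf uu) => /= ->.
Qed.

Lemma independent_or u v :
  [\/ u = 0, exists c, v = c *: u | row_free (col_mx u v)].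
Proof.
have [->|u0] := eqVneq u 0; first exact: Or31.
have [[c ->]|nv] := pselect (exists c, v = c *: u); first by apply: Or32; exists c.
apply: Or33; apply: inj_row_free => a.
rewrite -[a]hsubmxK mul_row_col [lsubmx a]mx11_scalar [rsubmx a]mx11_scalar.
rewrite !mul_scalar_mx; set s := lsubmx a 0 0; set t := rsubmx a 0 0 => E.
have t0 : t = 0.
  apply/eqP; apply: contrapT => /negP t0; apply: nv; exists (- (s / t)).
  apply: (scalerI t0); rewrite scalerA mulrN mulrCA divff // mulr1 scaleNr.
  by apply/eqP; rewrite -addr_eq0 addrC E.
move: E; rewrite t0 scale0r addr0 => /eqP; rewrite scaler_eq0 (negPf u0) orbF => /eqP ->.
by rewrite -scalemx1 scale0r row_mx0.
Qed.

(** Independent vectors are covered by the sectional curvature, dependent ones by antisymmetry. *)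
Lemma curv_defect_diag u v : curv_defect u v v u = 0.
Proof.
have zero v' w z : curv_defect 0 v' w z = 0.
  have := curv_defect_linear (-1) 0 0 v' w z.
  by rewrite scaler0 addr0 mulN1r addNr.
have scale c u' v' w z : curv_defect (c *: u') v' w z = c * curv_defect u' v' w z.
  by have := curv_defect_linear c u' 0 v' w z; rewrite zero !addr0.
have diag0 v' w z : curv_defect v' v' w z = 0.
  have := curv_defect12 v' v' w z; lra.
have [->|[c ->]|uv] := independent_or u v; first exact: zero.
  by rewrite curv_defect12 scale diag0 mulr0 oppr0.
have := curv_sectional uv; rewrite /sectional curvature_opE /curv_defect => <-.
rewrite (innerC v u) -expr2.
rewrite [inner g v v * _]mulrC divfK ?subrr //; exact: gram_neq0.
Qed.

Lemma constant_curvature i j k l :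
  curvature G l k i j x = K * ((l == i)%:R * g j k - (l == j)%:R * g i k).
Proof.
have D0 u v w z : curv_defect u v w z = 0.
  apply: (@curvature_form_eq0 R 'rV[R]_n curv_defect) => //.
  - by move=> a b c d e; have := curv_defect_linear 1 a b c d e; rewrite scale1r mul1r.
  - exact: curv_defect12.
  - exact: curv_defect34.
  - exact: curv_defect_bianchi.
  - exact: curv_defect_diag.
pose e (m : 'I_n) : 'rV[R]_n := delta_mx 0 m.
have eg a b : inner g (e a) (e b) = g a b.
  by rewrite /inner /e -rowE trmx_delta -colE !mxE.
(* This vector is orthogonal to everything, hence zero by definiteness; its coordinates are the
   claim. *)
pose y := e k *m curv_end (e i) (e j) - K *: (g j k *: e i - g i k *: e j).
have y0 z : inner g y z = 0.
  rewrite -[RHS](D0 (e i) (e j) (e k) z) /curv_defect /y.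
  by rewrite -scaleNr innerDl innerZl -scaleNr innerDl !innerZl !eg; ring.
have /eqP : y = 0.
  apply/eqP/negPn/negP => /g_pos; have := y0 y; rewrite /inner => ->.
  by rewrite ltxx.
rewrite subr_eq0 => /eqP /(congr1 (fun r : 'rV[R]_n => r 0 l)).
have -> : curv_end (e i) (e j) = curv_mx i j.
  rewrite /curv_end (bigD1 i) //= (bigD1 j) //= !mxE !eqxx mul1r scale1r.
  rewrite big1 => [|q /negPf qj]; last by rewrite !mxE qj andbF mulr0 scale0r.
  rewrite addr0 big1 ?addr0 // => p /negPf pi; rewrite big1 // => q _.
  by rewrite !mxE pi andbF mul0r scale0r.
rewrite -rowE !mxE => ->; rewrite !eqxx /=; ring.
Qed.

End PointwiseCurvature.

(** * The frame calculus of a local orthonormal frame *)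

Lemma slot_act_ord (A : comPzRingType) n m (w : 'I_n -> 'I_n -> A)
    (j : 'I_m -> 'I_n) (T : seq 'I_n -> A) :
  slot_act w (map j (enum 'I_m)) T =
  \sum_b \sum_l w (j b) l * T (map (fun c => if c == b then l else j c) (enum 'I_m)).
Proof.
elim: m j T => [|m IH] j T.
  have -> : enum 'I_0 = [::] by apply: size0nil; rewrite size_enum_ord.
  by rewrite big_ord0.
rewrite enum_ordSl /= big_ord_recl -map_comp IH; congr (_ + _).
  by apply: eq_bigr => l _; rewrite -map_comp.
apply: eq_bigr => b _; apply: eq_bigr => l _; rewrite -map_comp /=.
by congr (_ * T (_ :: _)); apply: eq_map => c /=.
Qed.

Section LocalGeometry.
Variables (R : realType) (n : nat) (D : set 'rV[R]_n).
Hypothesis openD : open D.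
Variables (G : 'rV[R]_n -> 'M[R]_n) (X : 'rV[R]_n -> 'I_n -> 'rV[R]_n).
Variables (h : 'rV[R]_n -> R[i]) (K : R) (lam : R[i]).
Hypothesis G_smooth : forall i j, smooth_on D (fun x => G x i j).
Hypothesis G_sym : forall x, D x -> (G x)^T = G x.
Hypothesis G_pos : forall x (v : 'rV[R]_n), D x -> v != 0 -> 0 < (v *m G x *m v^T) 0 0.
Hypothesis X_smooth : forall i j, smooth_on D (fun x => X x i 0 j).
Hypothesis X_orthonormal : forall x, D x ->
  forall i j, inner (G x) (X x i) (X x j) = (i == j)%:R.
Hypothesis G_curv : forall x (u v : 'rV[R]_n), D x -> row_free (col_mx u v) ->
  sectional G x u v = K.
Hypothesis h_smooth : smoothC_on D h.
Hypothesis h_eigen : forall x, D x -> laplacian G X h x = - lam * h x.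

Local Notation A := (smoothRing openD).
Local Notation RC := (real_complex R).

Definition frame_mx x : 'M[R]_n := \matrix_(a, l) X x a 0 l.

Lemma frame_mx_orthonormal x : D x -> frame_mx x *m G x *m (frame_mx x)^T = 1%:M.
Proof.
move=> Dx; apply/matrixP => a b; rewrite !mxE -(X_orthonormal Dx a b) /inner mxE.
apply: eq_bigr => l _; rewrite !mxE; congr (_ * _).
by apply: eq_bigr => m _; rewrite !mxE.
Qed.

Lemma frame_mx_dual x : D x -> G x *m (frame_mx x)^T *m frame_mx x = 1%:M.
Proof. by move=> Dx; apply: mulmx1C; rewrite mulmxA frame_mx_orthonormal. Qed.

Lemma metric_unit x : D x -> G x \in unitmx.
Proof.
by move=> Dx; have := frame_mx_dual Dx; rewrite -mulmxA => /mulmx1_unit[].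
Qed.

(** Expresses the inverse metric polynomially in the frame, whence the smoothness of the Christoffel
    symbols. *)
Lemma invmx_metric x : D x -> invmx (G x) = (frame_mx x)^T *m frame_mx x.
Proof.
move=> Dx; rewrite -[LHS]mulmx1 -(frame_mx_dual Dx) -!mulmxA.
by rewrite (mulmxA (invmx _)) mulVmx ?mul1mx // metric_unit.
Qed.

Lemma christoffel_smooth l i j : smooth_on D (christoffel G l i j).
Proof.
pose inv m x := \sum_a X x a 0 l * X x a 0 m.
pose dG m x := pd i (fun y => G y j m) x + pd j (fun y => G y i m) x
               - pd m (fun y => G y i j) x.
have inv_smooth m : smooth_on D (inv m).
  by apply: (smooth_on_sum openD) => a; apply: (smooth_onM openD).
have dG_smooth m : smooth_on D (dG m).
  apply: (smooth_onB openD); last exact: smooth_on_pd.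
  by apply: (smooth_onD openD); exact: smooth_on_pd.
have := smooth_onM openD (smooth_on_cst openD 2^-1)
  (smooth_on_sum openD (index_enum 'I_n) (fun m => smooth_onM openD (inv_smooth m) (dG_smooth m))).
apply: (eq_smooth_on openD) => x Dx.
rewrite /christoffel; congr (_ * _); apply: eq_bigr => m _; congr (_ * _).
rewrite invmx_metric // mxE; apply: eq_bigr => a _.
by rewrite !mxE.
Qed.

Lemma levi_civita x : D x ->
  (forall l i j, christoffel G l i j x = christoffel G l j i x) /\
  (forall k i j, pd k (fun y => G y i j) x
     = \sum_l (christoffel G l k i x * G x l j + christoffel G l k j x * G x i l)).
Proof.
move=> Dx.
have Gs : \forall y \near x, (G y)^T = G y.
  have : nbhs x D by exact: open_nbhs_nbhs.
  by apply: filterS => y; exact: G_sym.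
have H := christoffel_levi_civita (fun l i j => christoffel G l i j x) Gs (metric_unit Dx).
by apply H.
Qed.

Definition real_fun f (fs : smooth_on D f) : A := smooth_restrict openD (smoothC_on_real openD fs).

Lemma eval_real f (fs : smooth_on D f) x : D x -> feval (real_fun fs) x = (f x)%:C.
Proof. by move=> Dx; rewrite eval_restrict. Qed.

Lemma eval_partial_real k f (fs : smooth_on D f) x : D x ->
  feval (partial k (real_fun fs)) x = (pd k f x)%:C.
Proof. by move=> Dx; rewrite partial_restrict // pdC_real. Qed.

Definition metric_A : 'M[A]_n := \matrix_(i, j) real_fun (G_smooth i j).
Definition frame_A : 'M[A]_n := \matrix_(a, l) real_fun (X_smooth a l).
Definition christoffel_A k : 'M[A]_n :=
  \matrix_(m, l) real_fun (christoffel_smooth l k m).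

Definition eval_mx p q (M : 'M[A]_(p, q)) x : 'M[R[i]]_(p, q) :=
  \matrix_(i, j) feval (M i j) x.

Lemma eval_mx_inj p q (M N : 'M[A]_(p, q)) :
  (forall x, D x -> eval_mx M x = eval_mx N x) -> M = N.
Proof.
move=> MN; apply/matrixP => i j; apply: eval_inj => x Dx.
by have /matrixP /(_ i j) := MN x Dx; rewrite !mxE.
Qed.

Section AtPoint.
Variables (x : 'rV[R]_n) (Dx : D x).

Lemma eval_mxM p q r (M : 'M[A]_(p, q)) (N : 'M[A]_(q, r)) :
  eval_mx (M *m N) x = eval_mx M x *m eval_mx N x.
Proof.
apply/matrixP => i j; rewrite !mxE eval_sum //; apply: eq_bigr => l _.
by rewrite evalM // !mxE.
Qed.

Lemma eval_mxD p q (M N : 'M[A]_(p, q)) : eval_mx (M + N) x = eval_mx M x + eval_mx N x.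
Proof. by apply/matrixP => i j; rewrite !mxE evalD. Qed.

Lemma eval_mxT p q (M : 'M[A]_(p, q)) : eval_mx M^T x = (eval_mx M x)^T.
Proof. by apply/matrixP => i j; rewrite !mxE. Qed.

Lemma eval_mx1 : eval_mx (1%:M : 'M[A]_n) x = map_mx RC 1%:M.
Proof. by apply/matrixP => i j; rewrite !mxE eval_nat // rmorph_nat. Qed.

Lemma eval_metric : eval_mx metric_A x = map_mx RC (G x).
Proof. by apply/matrixP => i j; rewrite !mxE eval_real. Qed.

Lemma eval_frame : eval_mx frame_A x = map_mx RC (frame_mx x).
Proof. by apply/matrixP => i j; rewrite !mxE eval_real. Qed.

Lemma eval_form_curv i j :
  eval_mx (form_curv (@partial R n D openD) christoffel_A i j) x =
  map_mx RC (curv_mx G x i j).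
Proof.
apply/matrixP => k l; rewrite /form_curv !mxE evalD // evalD // evalN //.
rewrite evalD // evalN // !eval_partial_real // /curvature !rmorphD !rmorphN /=.
rewrite rmorph_sum /=; congr (_ + _).
rewrite !eval_sum // -sumrB; apply: eq_bigr => m _.
rewrite rmorphB !evalM // !mxE !eval_real //; congr (_ - _).
  by rewrite [RHS]rmorphM.
by rewrite [RHS]rmorphM.
Qed.

End AtPoint.

Lemma metric_A_sym : metric_A^T = metric_A.
Proof.
apply: eval_mx_inj => x Dx; rewrite eval_mxT eval_metric //.
by rewrite map_trmx G_sym.
Qed.

Lemma frame_coframe : frame_A *m coframe metric_A frame_A = 1%:M.
Proof.
apply: eval_mx_inj => x Dx; rewrite /coframe !eval_mxM // eval_mxT eval_metric // eval_frame //.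
by rewrite eval_mx1 // -(frame_mx_orthonormal Dx) !map_mxM map_trmx mulmxA.
Qed.

Lemma coframe_frame : coframe metric_A frame_A *m frame_A = 1%:M.
Proof.
apply: eval_mx_inj => x Dx; rewrite /coframe !eval_mxM // eval_mxT eval_metric // eval_frame //.
by rewrite eval_mx1 // -(frame_mx_dual Dx) !map_mxM map_trmx.
Qed.

Lemma christoffel_A_sym k m l : christoffel_A k m l = christoffel_A m k l.
Proof.
apply: eval_inj => x Dx; rewrite !mxE !eval_real //.
by rewrite (levi_civita Dx).1.
Qed.

Lemma christoffel_A_metric k :
  dmx (@partial R n D openD) k metric_A =
  christoffel_A k *m metric_A + metric_A *m (christoffel_A k)^T.
Proof.
apply/matrixP => i j; apply: eval_inj => x Dx; rewrite !mxE evalD //.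
rewrite eval_partial_real // (levi_civita Dx).2 rmorph_sum !eval_sum // -big_split.
apply: eq_bigr => l _; rewrite rmorphD !evalM // !mxE !eval_real //=.
by congr (_ + _); rewrite [LHS]rmorphM // mulrC.
Qed.

Lemma christoffel_A_curv i j :
  dmx (@partial R n D openD) i (christoffel_A j)
  - dmx (@partial R n D openD) j (christoffel_A i)
  + (christoffel_A j *m christoffel_A i - christoffel_A i *m christoffel_A j) =
  \matrix_(k, l) (smooth_cst openD K%:C *
     ((l == i)%:R * metric_A j k - (l == j)%:R * metric_A i k)).
Proof.
apply: eval_mx_inj => x Dx; rewrite [LHS]eval_form_curv //.
apply/matrixP => k l; rewrite !mxE.
rewrite (@constant_curvature R n G x (G_sym Dx) (fun v => G_pos Dx) _ _ K) //.
- by rewrite evalM // eval_cst // evalD // evalN // !evalM // !eval_nat // !eval_real //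
    rmorphM rmorphB !rmorphM !rmorph_nat.
(* The pointwise symmetries of the curvature are obtained by evaluating identities of the
   differential ring at [x]. *)
- move=> p q; apply: (map_mx_inj (f := RC)).
  have := form_curv_anti (@partialD _ _ _ openD) (@partialM _ _ _ openD) (@partialC _ _ _ openD)
     christoffel_A_metric p q.
  move=> /(congr1 (fun M => eval_mx M x)).
  rewrite eval_mxD // !eval_mxM // eval_mxT !eval_form_curv // !eval_metric //.
  rewrite map_trmx -!map_mxM -map_mxD => ->.
  by apply/matrixP => a b; rewrite !mxE eval0.
- move=> p q r s; apply: (@complexI R).
  have := form_curv_bianchi (@partial _ _ _ openD) christoffel_A_sym p q r s.
  move=> /(congr1 (fun a => feval a x)); rewrite !evalD // eval0 //.
  have E a b c : feval (form_curv (@partial R n D openD) christoffel_A a b c s) x =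
     (curv_mx G x a b c s)%:C.
    by have /matrixP /(_ c s) := eval_form_curv Dx a b; rewrite !mxE.
  by rewrite !E !rmorphD.
- move=> u v; exact: G_curv.
Qed.

(** Recursion is on the order [m], because the connection terms evaluate the previous tensor on
    words that are not subwords of [s]. The value 0 is never reached from [nabla_A], where [m] is
    the length of the word. *)
Fixpoint covder_A m (s : seq 'I_n) : A :=
  if m is m'.+1 then
    if s is k :: s' then
      partial k (covder_A m' s') - slot_act (christoffel_A k) s' (covder_A m')
    else 0
  else smooth_restrict openD h_smooth.

Definition nabla_A s := covder_A (size s) s.

Lemma nabla_A_cons k s :
  nabla_A (k :: s) = partial k (nabla_A s) - slot_act (christoffel_A k) s nabla_A.
Proof.
rewrite /nabla_A /=; congr (_ - _); apply: eq_slot_act => // t st.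
by rewrite st.
Qed.

Lemma eval_covder m (j : {ffun 'I_m -> 'I_n}) x : D x ->
  feval (covder_A m (map j (enum 'I_m))) x = nabla G h j x.
Proof.
elim: m j x => [|m IH] j x Dx; first by rewrite eval_restrict.
rewrite enum_ordSl /= -map_comp.
have -> : map (j \o lift ord0) (enum 'I_m) = map (idx_tail j) (enum 'I_m).
  by apply: eq_map => b /=; rewrite ffunE.
rewrite evalD // evalN // eval_partial // /covd; congr (_ - _).
  by apply: (eq_pdC_on openD) => // y Dy; exact: IH.
rewrite slot_act_ord eval_sum //; apply: eq_bigr => b _.
rewrite eval_sum //; apply: eq_bigr => l _; rewrite evalM // mxE eval_real //.
rewrite -IH //; congr (_ * feval (covder_A m _) x).
by apply: eq_map => c; rewrite [RHS]ffunE.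
Qed.

Lemma eval_frame_comp m (w : 'I_m -> 'I_n) x : D x ->
  feval (frame_comp frame_A (map w (enum 'I_m)) nabla_A) x =
  \sum_(j : {ffun 'I_m -> 'I_n}) (\prod_b X x (w b) 0 (j b))%:C * nabla G h j x.
Proof.
move=> Dx; rewrite frame_comp_sum_ffun eval_sum //; apply: eq_bigr => j _.
rewrite evalM // eval_prod // rmorph_prod -eval_covder // /nabla_A.
rewrite size_map size_enum_ord; congr (_ * _).
by apply: eq_bigr => b _; rewrite mxE eval_real.
Qed.

Lemma nabla_A_laplacian :
  \sum_a frame_comp frame_A [:: a; a] nabla_A = - smooth_cst openD lam * nabla_A [::].
Proof.
apply: eval_inj => x Dx; rewrite evalM // evalN // eval_cst //.
rewrite [feval (nabla_A _) x]eval_restrict // -h_eigen // eval_sum //.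
apply: eq_bigr => a _.
have -> : [:: a; a] = map (fun=> a) (enum 'I_2) by rewrite !enum_ordSl enum_ord0.
rewrite eval_frame_comp //; apply: eq_bigr => j _; congr (_ * _).
rewrite !ffunE big_ord_recl big_ord1 [LHS]rmorphM.
by congr ((X x a 0 (j _))%:C * (X x a 0 (j _))%:C); exact: val_inj.
Qed.

Definition local_calculus : frame_calculus n K%:C lam :=
  moving_frame_calculus (@partialD _ _ _ openD) (@partialM _ _ _ openD)
    (@partial_cst _ _ _ openD) (@partialC _ _ _ openD) metric_A_sym frame_coframe
    coframe_frame christoffel_A_sym christoffel_A_metric christoffel_A_curv
    nabla_A_cons nabla_A_laplacian.

Lemma eval_hess_ord m (w : 'I_m -> 'I_n) x : D x ->
  feval (hess local_calculus (map w (enum 'I_m)) : A) x =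
  \sum_(j : {ffun 'I_m -> 'I_n}) (\prod_b X x (w b) 0 (j b))%:C * nabla G h j x.
Proof. exact: eval_frame_comp. Qed.

End LocalGeometry.

(** * The permuted power of $\theta$ as a paired word, and the theorem *)

Lemma ltn_half_muln2 k (b : 'I_(k * 2)) : (b./2 < k)%N.
Proof. by have := ltn_ord b; lia. Qed.

Definition pair_of k (b : 'I_(k * 2)) : 'I_k := Ordinal (ltn_half_muln2 b).

(** The power sums over one frame index per factor [theta]; slots $2i$ and $2i+1$ carry the index of
    factor $i$, which is [pair_of]. *)
Lemma tpow_theta (R : realType) n (E : 'I_n -> 'rV[R]_n) k
    (j : {ffun 'I_(k * 2) -> 'I_n}) :
  tpow (theta E) k j =
  \sum_(r : {ffun 'I_k -> 'I_n}) (\prod_b E (r (pair_of b)) 0 (j b))%:C.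
Proof.
elim: k j => [|k IH] j.
  rewrite ffunE (big_pred1 [ffun i : 'I_0 => False_rect _ (notF (ltn_ord i))]) => [|r] /=.
    by rewrite big_ord0.
  by apply/esym/eqP/ffunP => -[].
rewrite sum_ffun_cons ffunE IH /theta sum_ffunE mulr_suml.
apply: eq_bigr => a _; rewrite mulr_sumr; apply: eq_bigr => r _.
pose P (b : 'I_(2 + k * 2)) :=
  E (ffun_cons (a, r) (@pair_of k.+1 b)) 0 (j b).
have -> : \prod_b E (ffun_cons (a, r) (pair_of b)) 0 (j b) = \prod_b P b by [].
rewrite big_split_ord [RHS]rmorphM; congr (_ * _).
  rewrite !ffunE big_ord_recl big_ord1 [RHS]rmorphM /P.
  have E0 (b : 'I_2) : @pair_of k.+1 (lshift (k * 2) b) = ord0.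
    by apply: val_inj => /=; have := ltn_ord b; lia.
  rewrite !E0 !ffunE unlift_none.
  by congr ((E a 0 (j _))%:C * (E a 0 (j _))%:C); exact: val_inj.
congr (_%:C); apply: eq_bigr => b _; rewrite /P.
have -> : @pair_of k.+1 (rshift 2 b) = lift ord0 (pair_of b).
  by apply: val_inj => /=; rewrite /bump /=; lia.
by rewrite !ffunE liftK.
Qed.

Lemma paired_word_pair_of k (s : 'S_(k * 2)) :
  paired_word (map (fun b => pair_of (s b)) (enum 'I_(k * 2))).
Proof.
move=> z; rewrite -size_filter; apply/orP; right; apply/eqP.
rewrite filter_map size_map size_filter -[count _ _]sum1_count big_enum_cond /=.
rewrite (reindex_inj (h := (s^-1)%g)) /=; last exact: perm_inj.
have h0 : (z * 2 < k * 2)%N by have := ltn_ord z; lia.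
have h1 : (z * 2 + 1 < k * 2)%N by have := ltn_ord z; lia.
rewrite sum1_card; transitivity #|pred2 (Ordinal h0) (Ordinal h1)|.
  apply: eq_card => b; rewrite [LHS]unfold_in !inE /= permKV -!val_eqE /=.
  by apply/idP/idP; lia.
by rewrite card2 -val_eqE /=; have -> : (z * 2 != z * 2 + 1)%N by lia.
Qed.

Theorem theorem4p1 (R : realType) (n : nat) (M : riemannianManifold R n)
    (K : R) (U : set M) (f : M -> R[i]) (lam : R[i]) (k : nat)
    (hn : (2 <= n)%N)
    (hconn : connected [set: M])
    (hcomplete : geodesically_complete M)
    (hcurv : constant_sectional_curvature M K)
    (hK : K != 0)
    (hU : open U)
    (hf : smooth_function U f)
    (heig : laplace_eigenfunction U f lam)
    (hk : (1 <= k)%N)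
    (sigma : 'S_(k * 2)) :
  exists c : R[i],
    forall (a : chart M) (V : set 'rV[R]_n)
           (X : 'rV[R]_n -> 'I_n -> 'rV[R]_n),
      local_frame U a V X ->
      forall x, V x ->
        nabla_at (metric a) (f \o psi a)
          (tperm_act sigma (tpow (theta (X x)) k)) x = c * f (psi a x).
Proof.
have n0 : n%:R != 0 :> R[i] by rewrite pnatr_eq0; lia.
pose w (b : 'I_(k * 2)) := pair_of ((sigma^-1)%g b).
(* After permutation, slot [b] belongs to the pair of [sigma^-1 b]. Every letter of ['I_k] occurs in
   this word, so [contract] is the contraction itself without powers of [n], and [c] is obtained
   before any chart or frame. *)
have [c ceq] := @paired_contraction R[i] n K%:C lam 'I_k n0 _
  (paired_word_pair_of (sigma^-1)%g).
exists c => a V X [oV VU [Xsm Xon]] x Vx.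
have Vcod y : V y -> cod a y by move=> /VU [].
have sub h : smooth_on (cod a) h -> smooth_on V h by move=> hs s y /Vcod; exact: hs.
have subU h : smooth_on (chart_part U a) h -> smooth_on V h by move=> hs s y /VU; exact: hs.
have fsm : smoothC_on V (f \o psi a) by case: (hf a) => fr fi; split; exact: subU.
pose Y := local_calculus oV (fun i j => sub _ (metric_smooth (a := a) i j))
  (fun y Vy => Defs.metric_sym (Vcod y Vy)) (fun y v Vy => Defs.metric_pos (Vcod y Vy))
  Xsm Xon (fun y u v Vy => hcurv a y u v (Vcod y Vy)) fsm
  (fun y Vy => heig a V X (And3 oV VU (conj Xsm Xon)) y Vy).
have := congr1 (fun y : smoothRing oV => feval y x) (ceq Y).
rewrite evalM // eval_cst //.
have -> : feval (hess Y [::] : smoothRing oV) x = f (psi a x) by rewrite eval_restrict.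
move=> <-; rewrite /contract eval_sum // /nabla_at.
(* Sum over the coordinate indices [j] inside and over the frame indices [r] outside; the inner sum
   is then one frame component of [hess]. *)
transitivity (\sum_(r : {ffun 'I_k -> 'I_n}) \sum_(j : {ffun 'I_(k * 2) -> 'I_n})
   (\prod_b X x (r (w b)) 0 (j b))%:C * nabla (metric a) (f \o psi a) j x).
  rewrite exchange_big; apply: eq_bigr => j _; rewrite -mulr_suml; congr (_ * _).
  rewrite ffunE tpow_theta; apply: eq_bigr => r _; congr (_%:C).
  rewrite (reindex_inj (h := (sigma^-1)%g)) /=; last exact: perm_inj.
  by apply: eq_bigr => b _; rewrite ffunE permKV.
apply: eq_bigr => r _; rewrite -map_comp; apply/esym; exact: eval_hess_ord.
Qed.
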